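(* Let $b>2$ and $q$ be integers with $1\le q<b$. Then $\mu_{q,b}$ has infinitely many orthogonal exponentials (i.e. there is an infinite set $\Lambda\subset\mathbb{R}$ such that the functions $e^{2\pi i\lambda x}$, $\lambda\in\Lambda$, are mutually orthogonal in $L^2(\mu_{q,b})$) if and only if $\gcd(q,b)>1$. Moreover, if $q$ divides $b$, then $\mu_{q,b}$ is a spectral measure.
   Context: For integers $b>2$ and $1\le q<b$, $\mu_{q,b}$ denotes the unique Borel probability measure $\mu$ on $\mathbb{R}$ satisfying $\mu(E)=\sum_{i=0}^{q-1}\frac1q\,\mu(f_i^{-1}(E))$ for all Borel sets $E$, where $f_i(x)=b^{-1}(x+i)$, $i=0,1,\dots,q-1$. A compactly supported Borel probability measure $\mu$ on $\mathbb{R}$ is a spectral measure if there is a countable set $\Lambda\subset\mathbb{R}$ such that $\{e^{2\pi i\lambda x}:\lambda\in\Lambda\}$ is an orthonormal basis of $L^2(\mu)$. *)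

(* Defs.v *)
From HB Require Import structures.
From mathcomp Require Import all_boot all_order all_algebra.
From mathcomp Require Import all_classical all_reals all_analysis.
From mathcomp Require Import complex.

Set Implicit Arguments.
Unset Strict Implicit.
Unset Printing Implicit Defensive.

Import Order.TTheory GRing.Theory Num.Theory.
Import numFieldTopology.Exports numFieldNormedType.Exports.

Local Open Scope classical_set_scope.
Local Open Scope ring_scope.
Local Open Scope complex_scope.

Definition ifs_map (R : realType) (b i : nat) (x : R) : R :=
  b%:R^-1 * (x + i%:R).

(* [mu] is $\mu_{q,b}$: for 1 <= q and 1 < b, this invariance equation has
   exactly one solution among the Borel probability measures on R. *)
Definition is_mu_qb (R : realType) (q b : nat)
    (mu : probability (measurableTypeR R) R) : Prop :=
  forall E : set (measurableTypeR R), measurable E ->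
    mu E = (\sum_(i < q) (q%:R^-1)%:E * mu (@ifs_map R b i @^-1` E))%E.

Section complex_L2.
Context (R : realType) (mu : probability (measurableTypeR R) R).
Implicit Types f g : measurableTypeR R -> R[i].

Definition cintegral f : R[i] :=
  Complex (\int[mu]_x complex.Re (f x)) (\int[mu]_x complex.Im (f x)).

Definition L2norm f : \bar R :=
  Lnorm mu 2%:E (fun x => (ComplexField.Normc.normc (f x))%:E).

Definition in_L2 f : Prop :=
  [/\ measurable_fun setT (fun x => complex.Re (f x)),
      measurable_fun setT (fun x => complex.Im (f x)) &
      (L2norm f < +oo)%E].

Definition L2inner f g : R[i] := cintegral (fun x => f x * (g x)^*).

(* Elements of L^2(mu) are represented by functions; no quotient by a.e.
   equality is needed, as [L2norm] and [L2inner] are invariant under it. *)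
Definition orthonormal_basis (I : eqType) (A : set I)
    (e : I -> measurableTypeR R -> R[i]) : Prop :=
  [/\ forall i, A i -> in_L2 (e i),
      forall i j, A i -> A j -> L2inner (e i) (e j) = (i == j)%:R &
      forall f, in_L2 f -> forall eps : R, 0 < eps ->
        exists (s : seq I) (c : I -> R[i]),
          (forall i, i \in s -> A i) /\
          (L2norm (fun x => f x - \sum_(i <- s) c i * e i x)%R < eps%:E)%E].

Definition expfun (l : R) (x : measurableTypeR R) : R[i] :=
  Complex (cos (2 * pi * l * x)) (sin (2 * pi * l * x)).

Definition infinitely_many_orthogonal_exponentials : Prop :=
  exists L : set R, infinite_set L /\
    (forall l m, L l -> L m -> l != m -> L2inner (expfun l) (expfun m) = 0).

Definition compactly_supported : Prop :=
  exists K : set R, compact K /\ mu (~` K) = 0%E.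

Definition spectral_measure : Prop :=
  compactly_supported /\
  exists L : set R, countable L /\ orthonormal_basis L expfun.

End complex_L2.

(* Main.v *)
Require Import Defs.
From HB Require Import structures.
From mathcomp Require Import all_boot all_order all_algebra.
From mathcomp Require Import all_classical all_reals all_analysis.
From mathcomp Require Import measurable_realfun.
From mathcomp Require Import complex archimedean ring lra zify.

(** Everything is read off the Fourier transform $\hat\mu$ of $\mu = \mu_{q,b}$,
    because the inner product of $e_\lambda$ and $e_{\lambda'}$ is
    $\hat\mu(\lambda - \lambda')$. Self-similarity gives the refinement equation
    $\hat\mu(t) = m(t/b)\,\hat\mu(t/b)$ with
    $m(t) = \frac1q \sum_{j<q} e^{2\pi i j t}$, and $m(t) = 0$ exactly when
    $qt \in \mathbb Z$ and $t \notin \mathbb Z$. Since $\mu$ lives on a compact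
    interval $[0, \rho]$, $\hat\mu$ does not vanish near $0$; iterating the equation
    shows that its zeros are the numbers $b^k a / q$ with $k \ge 1$ and
    $q \nmid a$ ([muhat_eq0P]).

    If $\gcd(q, b) = 1$, an orthogonal set injects into $\mathbb Z/q$ through
    $\lambda \mapsto q(\lambda - \lambda_0)$, because $b^k$ is invertible modulo
    $q$, so it is finite ([finite_orthogonal]). If $d = \gcd(q, b) > 1$, the numbers
    $b^n / d$ are an infinite orthogonal set ([infinite_orthogonal]).

    If $q \mid b$, a spectrum is the set of all
    $\frac bq \sum_{k<n} b^k d_k$ with digits $d_k < q$. Let $\Lambda_n$ be the part
    with $n$ digits and $\hat\mu_n(t) = \prod_{k=1}^n m(t/b^k)$. Parseval's identity
    on $\mathbb Z/q$, applied digit by digit, gives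
    $\sum_{\lambda \in \Lambda_n} |\hat\mu_n(\xi - \lambda)|^2 = 1$ for every real
    $\xi$ ([sum_sqn_muhatn]). The quotient $\hat\mu / \hat\mu_n$ at $\xi - \lambda$
    is $\hat\mu(b^{-n}(\xi - \lambda))$; for large $n$ its argument is at most $1$ in
    absolute value, and as $\rho < 1/2$ this bounds the quotient below uniformly,
    while it tends to $1$ for each fixed $\lambda$. A Tannery argument then yields
    $\sum_\lambda |\hat\mu(\xi - \lambda)|^2 = 1$, that is, every exponential
    $e_\xi$, $\xi \in \mathbb R$, lies in the closed span of the $e_\lambda$
    ([exp_approx]).

    It remains to see that all the exponentials together span $L^2(\mu)$. The
    bounded functions that multiply the closed span into itself form an algebra that
    contains the exponentials and is closed under bounded pointwise limits
    ([multiplier_lim]). Iterating the cubic $(3y - y^3)/2$ on a sine produces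
    indicators of half-lines in this algebra, hence indicators of all Borel sets
    ([multiplier_indic]), and simple functions are dense in $L^2(\mu)$
    ([spanned_L2]). *)

Set Implicit Arguments.
Unset Strict Implicit.
Unset Printing Implicit Defensive.

Import Order.TTheory GRing.Theory Num.Theory.
Import numFieldTopology.Exports numFieldNormedType.Exports.

Local Open Scope classical_set_scope.
Local Open Scope ring_scope.
Local Open Scope complex_scope.

(** * The squared modulus, the characters of the line and the digit mask *)

Section squared_modulus.
Variable R : realType.
Implicit Types z w : R[i].

Definition sqn z : R := complex.Re z ^+ 2 + complex.Im z ^+ 2.

Lemma sqn_ge0 z : 0 <= sqn z.
Proof. by rewrite addr_ge0 ?sqr_ge0. Qed.

Lemma sqnM z w : sqn (z * w) = sqn z * sqn w.
Proof. by case: z w => [a b] [c d]; rewrite /sqn /=; ring. Qed.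

Lemma sqnN z : sqn (- z) = sqn z.
Proof. by case: z => a b; rewrite /sqn /= !sqrrN. Qed.

Lemma sqnD z w : sqn (z + w) <= 2 * sqn z + 2 * sqn w.
Proof.
case: z w => [a b] [c d]; rewrite /sqn /=.
by have := sqr_ge0 (a - c); have := sqr_ge0 (b - d); nra.
Qed.

Lemma sqnB z w : sqn (z - w) <= 2 * sqn z + 2 * sqn w.
Proof. by rewrite -(sqnN w) sqnD. Qed.

Lemma sqn0 : sqn 0 = 0.
Proof. by rewrite /sqn /= expr0n addr0. Qed.

Lemma sqn_eq0 z : (sqn z == 0) = (z == 0).
Proof.
case: z => a b; rewrite /sqn eq_complex /=.
by rewrite paddr_eq0 ?sqr_ge0// !sqrf_eq0.
Qed.

Lemma sqn_real (a : R) : sqn a%:C = a ^+ 2.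
Proof. by rewrite /sqn /= expr0n addr0. Qed.

Lemma conjcM z w : conjc (z * w) = conjc z * conjc w.
Proof. exact: rmorphM. Qed.

Lemma conjc_sum (I : Type) (s : seq I) (F : I -> R[i]) :
  conjc (\sum_(i <- s) F i) = \sum_(i <- s) conjc (F i).
Proof. exact: (rmorph_sum (@conjc R)). Qed.

Lemma mul_conjC z : z * conjc z = (sqn z)%:C.
Proof.
by case: z => a b; apply/eqP; rewrite eq_complex /sqn /=; apply/andP; split;
  apply/eqP; ring.
Qed.

Lemma normc_sqr z : ComplexField.Normc.normc z ^+ 2 = sqn z.
Proof. by case: z => a b /=; rewrite sqr_sqrtr // addr_ge0 ?sqr_ge0. Qed.

End squared_modulus.

Section characters.
Variable R : realType.
Implicit Types s t x : R.

(** The character $t \mapsto e^{2\pi i t}$ of $\mathbb R/\mathbb Z$. *)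
Definition cis t : R[i] := Complex (cos (2 * pi * t)) (sin (2 * pi * t)).

Lemma expfunE t x : expfun t x = cis (t * x).
Proof. by rewrite /expfun /cis mulrA. Qed.

Lemma cisD s t : cis (s + t) = cis s * cis t.
Proof.
rewrite /cis !mulrDr cosD sinD; apply/eqP; rewrite eq_complex /=.
by rewrite eqxx/= addrC mulrC eqxx.
Qed.

Lemma cis0 : cis 0 = 1.
Proof. by rewrite /cis mulr0 cos0 sin0. Qed.

Lemma cisN t : cis (- t) = conjc (cis t).
Proof. by rewrite /cis mulrN cosN sinN. Qed.

Lemma sqn_cis t : sqn (cis t) = 1.
Proof. by rewrite /sqn /= cos2Dsin2. Qed.

Lemma cisX t n : cis (t * n%:R) = cis t ^+ n.
Proof.
elim: n => [|n IHn]; first by rewrite mulr0 cis0 expr0.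
by rewrite mulrSr mulrDr mulr1 cisD IHn exprSr.
Qed.

Lemma cis_nat n : cis n%:R = 1.
Proof.
rewrite -[n%:R]mul1r cisX; have -> : cis 1 = 1; last by rewrite expr1n.
by rewrite /cis mulr1 mulrC mulr_natr cos2pi sin2pi.
Qed.

Lemma cis_int t : t \is a Num.int -> cis t = 1.
Proof.
move=> /intrP[[n|n] ->]; first exact: cis_nat.
by rewrite NegzE mulrNz cisN (cis_nat n.+1) rmorph1.
Qed.

Lemma cis_eq1 t : cis t = 1 -> t \is a Num.int.
Proof.
move=> ht; pose u := t - (Num.floor t)%:~R.
have hu : cis u = 1 by rewrite cisD cisN (cis_int (intr_int _ _)) rmorph1 mulr1.
suff : u = 0 by move=> /eqP; rewrite subr_eq0 => /eqP ->; rewrite intr_int.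
have u0 : 0 <= u by rewrite subr_ge0 floor_le_tmp.
have u1 : u < 1 by rewrite ltrBlDr addrC -intrD1 floorD1_gt.
apply/eqP/negPn/negP => un0.
have up : 0 < u by rewrite lt0r un0.
have /sin_gt0_pi sp : 0 < pi * u < pi.
  by rewrite mulr_gt0 ?pi_gt0//= gtr_pMr ?pi_gt0.
have := congr1 (@complex.Re R) hu; rewrite /cis/=.
have -> : 2 * pi * u = (pi * u) *+ 2 by rewrite -mulrA mulr2n mulrDl mul1r.
rewrite cos_mulr2n cos2sin2 => h.
have : sin (pi * u) ^+ 2 = 0 by lra.
by move/eqP; rewrite sqrf_eq0 gt_eqF.
Qed.

End characters.

Section digit_mask.
Variables (R : realType) (q : nat).
Hypothesis q_gt0 : (0 < q)%N.
Implicit Types s t x : R.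

(** The mask polynomial: the Fourier transform of the uniform measure on the
    digits $0, \dots, q - 1$. *)
Definition dmask t : R[i] := (q%:R^-1)%:C * \sum_(j < q) cis (t * j%:R).

Let qR_neq0 : q%:R != 0 :> R.
Proof. by rewrite pnatr_eq0 -lt0n. Qed.

Let qC_neq0 : (q%:R^-1)%:C != 0 :> R[i].
Proof. by rewrite (_ : 0 = 0%:C)// (inj_eq (@complexI R)) invr_eq0. Qed.

Lemma sum_cis_nat t : t \is a Num.int -> \sum_(j < q) cis (t * j%:R) = q%:R.
Proof.
move=> ti; rewrite (eq_bigr (fun=> 1)) => [|j _]; last first.
  by rewrite cis_int// rpredM// natr_int.
by rewrite sumr_const card_ord.
Qed.

Lemma sum_cis_eq0 t : t \isn't a Num.int ->
  (\sum_(j < q) cis (t * j%:R) == 0) = (t * q%:R \is a Num.int).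
Proof.
move=> ti; have z1 : cis t - 1 != 0.
  by rewrite subr_eq0; apply: contra ti => /eqP/cis_eq1.
have e : (cis t - 1) * \sum_(j < q) cis (t * j%:R) = cis (t * q%:R) - 1.
  by under eq_bigr do rewrite cisX; rewrite -subrX1 cisX.
have -> : (\sum_(j < q) cis (t * j%:R) == 0) = (cis (t * q%:R) - 1 == 0).
  by rewrite -e mulf_eq0 (negbTE z1).
by rewrite subr_eq0; apply/eqP/idP => [/cis_eq1|/cis_int].
Qed.

Lemma dmask_eq0 t :
  (dmask t == 0) = (t * q%:R \is a Num.int) && (t \isn't a Num.int).
Proof.
rewrite /dmask mulf_eq0 (negbTE qC_neq0) orFb.
have [ti|ti] := boolP (t \is a Num.int); last by rewrite sum_cis_eq0// andbT.
by rewrite andbF sum_cis_nat// pnatr_eq0 -leqn0 leqNgt q_gt0.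
Qed.

Lemma dmaskD_int s t : s \is a Num.int -> dmask (t + s) = dmask t.
Proof.
move=> si; congr (_ * _); apply: eq_bigr => j _.
by rewrite mulrDl cisD [X in _ * X]cis_int ?mulr1// rpredM// natr_int.
Qed.

(** Parseval on $\mathbb Z/q$: the frequencies $d/q$ diagonalize the
    translations, so the masses at a full set of digits add up to $1$. *)
Lemma sum_sqn_dmask t : \sum_(d < q) sqn (dmask (t - d%:R / q%:R)) = 1.
Proof.
apply: (@complexI R); rewrite rmorph_sum /=.
under eq_bigr do rewrite -mul_conjC.
have e d : dmask (t - d%:R / q%:R) * conjc (dmask (t - d%:R / q%:R)) =
  ((q%:R^-1) ^+ 2)%:C * \sum_(j < q) \sum_(k < q)
     cis (t * (j%:R - k%:R)) * cis ((k%:R - j%:R) / q%:R * d%:R).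
  rewrite /dmask conjcM conjc_real mulrACA -rmorphM -expr2; congr (_ * _).
  rewrite conjc_sum big_distrl; apply: eq_bigr => j _.
  rewrite [LHS]big_distrr; apply: eq_bigr => k _.
  rewrite -cisN.
  rewrite -[LHS]cisD -[RHS]cisD; apply: congr1; ring.
under eq_bigr do rewrite e.
rewrite -big_distrr /= exchange_big /=.
have -> : \sum_(j < q) \sum_(i < q) \sum_(k < q)
     cis (t * (j%:R - k%:R)) * cis ((k%:R - j%:R) / q%:R * i%:R) =
   \sum_(j < q) (q%:R : R[i]).
  apply: eq_bigr => j _; rewrite exchange_big /= (bigD1 j)//= [X in _ + X]big1.
    rewrite subrr mulr0 mul0r addr0 cis0.
    under eq_bigr do rewrite mul0r cis0 mulr1.
    by rewrite sumr_const card_ord.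
  move=> k kj; rewrite -big_distrr/=.
  suff /eqP -> : \sum_(i < q) cis ((k%:R - j%:R) / q%:R * i%:R) == 0 :> R[i].
    by rewrite mulr0.
  have e' : (k%:R - j%:R) / q%:R * q%:R = k%:R - j%:R :> R by rewrite mulfVK.
  rewrite sum_cis_eq0 ?e' ?rpredB ?natr_int//.
  (* two distinct digits are not congruent modulo [q] *)
  apply/negP => /intrP[n hn].
  have hz : (k : int) - (j : int) = n * (q : int).
    by apply: (@intr_inj R); rewrite rmorphB rmorphM /= -hn; rewrite e'.
  have lk := ltn_ord k; have lj := ltn_ord j.
  have : (k : nat) != j by [].
  have [n0|n0|n0] := ltgtP n 0; [nia|nia|].
  by rewrite n0 in hz; lia.
rewrite sumr_const card_ord -(rmorph_nat (real_complex R)).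
by rewrite -rmorphMn -rmorphM /=; congr (_%:C); rewrite -mulr_natr; field.
Qed.

End digit_mask.

(** * Integration of bounded complex functions *)

Section measurable_complex.
Variable R : realType.
Local Notation T := (measurableTypeR R).
Implicit Types f g : T -> R[i].

Definition cmeasurable f : Prop :=
  measurable_fun setT (fun x => complex.Re (f x)) /\
  measurable_fun setT (fun x => complex.Im (f x)).

Definition cbounded f : Prop := exists M, forall x, sqn (f x) <= M.

Lemma complex_ReM (z w : R[i]) : @complex.Re R (z * w) =
  complex.Re z * complex.Re w - complex.Im z * complex.Im w.
Proof. by case: z w => [a b] [c d]. Qed.

Lemma complex_ImM (z w : R[i]) : @complex.Im R (z * w) =
  complex.Re z * complex.Im w + complex.Im z * complex.Re w.
Proof. by case: z w => [a b] [c d]. Qed.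

Lemma complex_ext (z w : R[i]) : @complex.Re R z = @complex.Re R w ->
  @complex.Im R z = @complex.Im R w -> z = w.
Proof. by case: z w => [a b] [c d] /= -> ->. Qed.

Lemma cmeasurableD f g : cmeasurable f -> cmeasurable g ->
  cmeasurable (fun x => f x + g x).
Proof.
move=> [mf1 mf2] [mg1 mg2]; split.
  rewrite (_ : (fun x => _) = (fun x => complex.Re (f x)) \+ (fun x => complex.Re (g x))).
    exact: measurable_funD.
  by apply/funext => x /=; rewrite raddfD.
rewrite (_ : (fun x => _) = (fun x => complex.Im (f x)) \+ (fun x => complex.Im (g x))).
  exact: measurable_funD.
by apply/funext => x /=; rewrite raddfD.
Qed.

Lemma cmeasurableM f g : cmeasurable f -> cmeasurable g ->
  cmeasurable (fun x => f x * g x).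
Proof.
move=> [mf1 mf2] [mg1 mg2]; split.
  by under eq_fun do rewrite complex_ReM; apply: measurable_funB; exact: measurable_funM.
by under eq_fun do rewrite complex_ImM; apply: measurable_funD; exact: measurable_funM.
Qed.

Lemma cmeasurable_cst c : cmeasurable (fun=> c).
Proof. by split; exact: measurable_cst. Qed.

Lemma cmeasurableB f g : cmeasurable f -> cmeasurable g ->
  cmeasurable (fun x => f x - g x).
Proof.
move=> mf mg; under eq_fun do rewrite -mulN1r.
by apply: cmeasurableD => //; apply: cmeasurableM => //; exact: cmeasurable_cst.
Qed.

Lemma cmeasurable_real (g : T -> R) : measurable_fun setT g ->
  cmeasurable (fun x => (g x)%:C).
Proof. by move=> mg; split => //=; exact: measurable_cst. Qed.

Lemma cmeasurable_sum I (s : seq I) (F : I -> T -> R[i]) :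
  (forall i, cmeasurable (F i)) -> cmeasurable (fun x => \sum_(i <- s) F i x).
Proof.
move=> mF; elim: s => [|i s IHs].
  by under eq_fun do rewrite big_nil; exact: cmeasurable_cst.
by under eq_fun do rewrite big_cons; apply: cmeasurableD.
Qed.

Lemma cmeasurable_exp t : cmeasurable (expfun t).
Proof.
split.
  rewrite (_ : (fun x => _) = (@cos R) \o (fun x => (2 * pi * t) * x)) //.
  apply: measurableT_comp; first exact: (continuous_measurable_fun (@continuous_cos R)).
  exact: mulrl_measurable.
rewrite (_ : (fun x => _) = (@sin R) \o (fun x => (2 * pi * t) * x)) //.
apply: measurableT_comp; first exact: (continuous_measurable_fun (@continuous_sin R)).
exact: mulrl_measurable.
Qed.

Lemma measurable_sqn f : cmeasurable f -> measurable_fun setT (fun x => sqn (f x)).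
Proof. by move=> [mf1 mf2]; apply: measurable_funD; exact: measurable_funX. Qed.

Lemma cboundedD f g : cbounded f -> cbounded g -> cbounded (fun x => f x + g x).
Proof.
move=> [M hM] [N hN]; exists (2 * M + 2 * N) => x.
by apply: (le_trans (sqnD _ _)); rewrite lerD// ler_pM2l.
Qed.

Lemma cboundedM f g : cbounded f -> cbounded g -> cbounded (fun x => f x * g x).
Proof.
move=> [M hM] [N hN]; exists (M * N) => x.
by rewrite sqnM ler_pM// sqn_ge0.
Qed.

Lemma cbounded_cst c : cbounded (fun=> c).
Proof. by exists (sqn c). Qed.

Lemma cbounded_sum I (s : seq I) (F : I -> T -> R[i]) :
  (forall i, cbounded (F i)) -> cbounded (fun x => \sum_(i <- s) F i x).
Proof.
move=> mF; elim: s => [|i s IHs].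
  by under eq_fun do rewrite big_nil; exact: cbounded_cst.
by under eq_fun do rewrite big_cons; apply: cboundedD.
Qed.

Lemma cbounded_exp t : cbounded (expfun t : T -> R[i]).
Proof. by exists 1 => x; rewrite expfunE sqn_cis. Qed.

End measurable_complex.

Section complex_integral.
Variables (R : realType) (mu : probability (measurableTypeR R) R).
Local Notation T := (measurableTypeR R).
Implicit Types f g : T -> R[i].

Lemma prob_bounded_integrable (g : T -> R) M : measurable_fun setT g ->
  (forall x, `|g x| <= M) -> mu.-integrable setT (EFin \o g).
Proof.
move=> mg gM; apply: measurable_bounded_integrable => //.
  by rewrite [ltLHS](probability_setT mu) ltry.
exists M; split; first by rewrite num_real.
by move=> N MN x _; apply: le_trans (gM x) _; exact: ltW.
Qed.

Lemma le_norm_sqn (a b : R) : `|a| <= 1 + (a ^+ 2 + b ^+ 2).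
Proof.
have := sqr_ge0 b; have := sqr_ge0 (`|a| - 1); rewrite -(real_normK (num_real a)).
by have := normr_ge0 a; nra.
Qed.

Lemma cint_integrable f : cmeasurable f -> cbounded f ->
  mu.-integrable setT (EFin \o (fun x => complex.Re (f x))) /\
  mu.-integrable setT (EFin \o (fun x => complex.Im (f x))).
Proof.
move=> [mf1 mf2] [M hM]; split; apply: (@prob_bounded_integrable _ (1 + M)) => // x.
  by apply: (le_trans (le_norm_sqn _ (complex.Im (f x)))); rewrite lerD2l hM.
apply: (le_trans (le_norm_sqn _ (complex.Re (f x)))).
by rewrite lerD2l addrC hM.
Qed.

Lemma cintegralD f g : cmeasurable f -> cbounded f -> cmeasurable g -> cbounded g ->
  cintegral mu (fun x => f x + g x) = cintegral mu f + cintegral mu g.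
Proof.
move=> mf bf mg bg; have [if1 if2] := cint_integrable mf bf.
have [ig1 ig2] := cint_integrable mg bg.
rewrite /cintegral; apply/eqP; rewrite eq_complex /=.
rewrite -!RintegralD//.
by apply/andP; split; apply/eqP; apply: eq_Rintegral => x _; rewrite raddfD.
Qed.

Lemma integrable_mull (a : R) (g : T -> R) : mu.-integrable setT (EFin \o g) ->
  mu.-integrable setT (EFin \o (fun x => a * g x)).
Proof.
by move/(integrableZl measurableT a); apply: eq_integrable => // x _ /=; rewrite EFinM.
Qed.

Lemma cintegralZ c f : cmeasurable f -> cbounded f ->
  cintegral mu (fun x => c * f x) = c * cintegral mu f.
Proof.
move=> mf bf; have [if1 if2] := cint_integrable mf bf.
case: c => a b; rewrite /cintegral; apply/eqP; rewrite eq_complex /=.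
rewrite -!RintegralZl// -RintegralB//; [|exact: integrable_mull..].
rewrite -RintegralD//; [|exact: integrable_mull..].
by apply/andP; split; apply/eqP; apply: eq_Rintegral => x _; rewrite ?complex_ReM ?complex_ImM.
Qed.

Lemma cintegral_cst c : cintegral mu (fun=> c) = c.
Proof.
case: c => a b; rewrite /cintegral /=.
have e r : \int[mu]_(_ in setT) r = r.
  by rewrite Rintegral_cst// [X in fine X](probability_setT mu) mulr1.
by rewrite !e.
Qed.

Lemma cintegral_sum I (s : seq I) (F : I -> T -> R[i]) :
  (forall i, cmeasurable (F i)) -> (forall i, cbounded (F i)) ->
  cintegral mu (fun x => \sum_(i <- s) F i x) = \sum_(i <- s) cintegral mu (F i).
Proof.
move=> mF bF; elim: s => [|i s IHs].
  by under [X in cintegral _ X]eq_fun do rewrite big_nil; rewrite big_nil cintegral_cst.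
under [X in cintegral _ X]eq_fun do rewrite big_cons.
by rewrite big_cons -IHs cintegralD//; [exact: cmeasurable_sum|exact: cbounded_sum].
Qed.

End complex_integral.

(** * Self-similarity and the refinement equation *)

Section self_similar.
Variables (R : realType) (b q : nat) (mu : probability (measurableTypeR R) R).
Hypotheses (q_gt0 : (0 < q)%N) (q_ltb : (q < b)%N) (hmu : is_mu_qb q b mu).
Local Notation T := (measurableTypeR R).

Let bR_gt0 : 0 < b%:R :> R.
Proof. by rewrite ltr0n (leq_ltn_trans _ q_ltb). Qed.

Let qR_gt0 : 0 < q%:R :> R.
Proof. by rewrite ltr0n. Qed.

Lemma measurable_ifs_map i : measurable_fun setT (@ifs_map R b i : T -> T).
Proof.
apply: measurableT_comp; first exact: mulrl_measurable.
exact: measurable_funD.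
Qed.

Let push (i : nat) : {measure set T -> \bar R} :=
  measure_function_pushforward__canonical__measure_function_Measure
    mu (measurable_ifs_map i).

Let qV_ge0 : 0 <= q%:R^-1 :> R.
Proof. by rewrite invr_ge0 ltW. Qed.

(** The invariance says that $\mu$ is the average of its images under the
    branches; integrals against a sum of image measures are computed termwise. *)
Lemma ge0_integral_self_similar (f : T -> \bar R) :
  measurable_fun setT f -> (forall x, 0 <= f x)%E ->
  (\int[mu]_x f x = \sum_(i < q) (q%:R^-1)%:E * \int[mu]_x f (ifs_map b i x))%E.
Proof.
move=> mf f0.
rewrite (eq_measure_integral (msum (fun i => mscale (NngNum qV_ge0) (push i)) q)).
  rewrite ge0_integral_measure_sum//; apply: eq_bigr => i _.
  rewrite ge0_integral_mscale// /push /=; congr (_ * _)%E.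
  by rewrite ge0_integral_pushforward//; exact: measurable_ifs_map.
by move=> A mA _; exact: (hmu mA).
Qed.

Lemma Rintegral_self_similar (g : T -> R) M : measurable_fun setT g ->
  (forall x, `|g x| <= M) ->
  \int[mu]_x g x = q%:R^-1 * \sum_(i < q) \int[mu]_x g (ifs_map b i x).
Proof.
move=> mg gM.
have mgi i : measurable_fun setT (fun x => g (ifs_map b i x)).
  exact: (measurableT_comp mg (measurable_ifs_map i)).
have ig := prob_bounded_integrable mu mg gM.
have igi i : mu.-integrable setT (EFin \o (fun x => g (ifs_map b i x))).
  exact: (prob_bounded_integrable mu (mgi i) (fun x => gM (ifs_map b i x))).
have icst : mu.-integrable setT (EFin \o (fun=> M : R)).
  by apply: (@prob_bounded_integrable _ mu _ `|M|).
(* the positive case applies after a shift by [M] *)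
have shift (h : T -> R) : mu.-integrable setT (EFin \o h) ->
    (\int[mu]_x (h x + M)%:E = (\int[mu]_x h x + M)%:E)%E.
  move=> ih; rewrite integralD_EFin// integral_cst// [X in (_ * X)%E](probability_setT mu) mule1.
  by rewrite EFinD fineK//; exact: integrable_fin_num.
have g0 x : 0 <= g x + M by have := gM x; rewrite ler_norml; lra.
have mf : measurable_fun setT (fun x : T => (g x + M)%:E).
  by apply/measurable_EFinP; apply: measurable_funD.
have := ge0_integral_self_similar mf g0.
rewrite shift//; under eq_bigr do rewrite shift// -EFinM mulrDr.
rewrite sumEFin big_split /= -mulr_sumr sumr_const card_ord.
rewrite -[X in _ = (_ + X)%:E]mulr_natr mulrAC mulVf ?gt_eqF// mul1r => e.
have {e} := congr1 fine e; exact: addIr.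
Qed.

Lemma cintegral_self_similar (f : T -> R[i]) : cmeasurable f -> cbounded f ->
  cintegral mu f =
  (q%:R^-1)%:C * \sum_(i < q) cintegral mu (fun x => f (ifs_map b i x)).
Proof.
move=> [mf1 mf2] [M hM].
have b1 x : `|complex.Re (f x)| <= 1 + M.
  by apply: (le_trans (le_norm_sqn _ (complex.Im (f x)))); rewrite lerD2l hM.
have b2 x : `|complex.Im (f x)| <= 1 + M.
  apply: (le_trans (le_norm_sqn _ (complex.Re (f x)))).
  by rewrite lerD2l addrC hM.
pose S := \sum_(i < q) cintegral mu (fun x => f (ifs_map b i x)).
rewrite -/S; apply: complex_ext.
  rewrite complex_ReM /= mul0r subr0 (Rintegral_self_similar mf1 b1).
  by congr (_ * _); rewrite /S raddf_sum.
rewrite complex_ImM /= mul0r addr0 (Rintegral_self_similar mf2 b2).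
by congr (_ * _); rewrite /S raddf_sum.
Qed.

(** The Fourier transform of $\mu_{q,b}$. *)
Definition muhat (t : R) : R[i] := cintegral mu (expfun t).

Lemma muhat0 : muhat 0 = 1.
Proof.
rewrite /muhat (_ : expfun 0 = fun=> 1) ?cintegral_cst//.
by apply/funext => x; rewrite expfunE mul0r cis0.
Qed.

Lemma muhat_refine t : muhat t = dmask q (t / b%:R) * muhat (t / b%:R).
Proof.
rewrite /muhat cintegral_self_similar; [|exact: cmeasurable_exp|exact: cbounded_exp].
rewrite /dmask -mulrA; congr (_ * _).
rewrite [RHS]mulr_suml; apply: eq_bigr => i _.
rewrite -cintegralZ; [|exact: cmeasurable_exp|exact: cbounded_exp].
congr cintegral; apply/funext => x /=.
rewrite !expfunE /ifs_map -cisD; congr cis; field.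
by rewrite gt_eqF.
Qed.

End self_similar.

(** * Support of the measure and lower bounds for its transform *)

Section support.
Variables (R : realType) (b q : nat) (mu : probability (measurableTypeR R) R).
Hypotheses (q_gt0 : (0 < q)%N) (q_ltb : (q < b)%N) (hmu : is_mu_qb q b mu).
Local Notation T := (measurableTypeR R).

Let b_gt1 : (1 < b)%N.
Proof. exact: leq_ltn_trans q_ltb. Qed.

Let bR_gt1 : 1 < b%:R :> R.
Proof. by rewrite ltr1n. Qed.

(** The largest point of the attractor, $\sum_{k \ge 1} (q - 1) b^{-k}$. *)
Definition rho : R := (q%:R - 1) / (b%:R - 1).

Let b1_gt0 : 0 < b%:R - 1 :> R.
Proof. by rewrite subr_gt0. Qed.

Lemma rho_ge0 : 0 <= rho.
Proof. by apply: divr_ge0; [rewrite subr_ge0 ler1n|exact: ltW]. Qed.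

Lemma rho_lt1 : rho < 1.
Proof. by rewrite ltr_pdivrMr// mul1r ltrD2r ltr_nat. Qed.

Lemma rhoE : b%:R * rho = rho + (q%:R - 1).
Proof. by rewrite /rho; field; rewrite gt_eqF. Qed.

(* the complement of the closed [s]-neighbourhood of [0, rho] *)
Let far (s : R) : set T := `]-oo, (- s)[%classic `|` `]rho + s, +oo[%classic.

Let measurable_far s : measurable (far s).
Proof. by apply: measurableU; exact: measurable_itv. Qed.

Let farP s x : far s x <-> (x < - s) \/ (rho + s < x).
Proof.
rewrite /far /= !in_itv /= andbT.
by split.
Qed.

Let ifs_map_far s i : (i < q)%N -> 0 <= s ->
  @ifs_map R b i @^-1` far s `<=` far (b%:R * s).
Proof.
move=> iq s0 x /farP; rewrite /ifs_map => h; apply/farP.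
have i1 : i%:R <= q%:R - 1 :> R by rewrite lerBrDr natr1 ler_nat.
have i0 : 0 <= i%:R :> R by [].
have bp : 0 < b%:R :> R by apply: lt_trans bR_gt1.
case: h => h; [left|right].
  move: h; rewrite ltr_pdivrMl//; lra.
by move: h; rewrite ltr_pdivlMl// mulrDr rhoE; lra.
Qed.

Let mu_far_le s : 0 <= s -> (mu (far s) <= mu (far (b%:R * s)))%E.
Proof.
move=> s0; rewrite (hmu (measurable_far s)).
apply: (@le_trans _ _ (\sum_(i < q) (q%:R^-1)%:E * mu (far (b%:R * s)))%E).
  apply: lee_sum => i _; apply: lee_wpmul2l; first by rewrite lee_fin invr_ge0.
  apply: le_measure; rewrite ?inE//; last exact: ifs_map_far.
  by rewrite -[X in measurable X]setTI; exact: measurable_ifs_map.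
rewrite -(fineK (fin_num_measure mu _ (measurable_far (b%:R * s)))).
rewrite -EFinM sumEFin sumr_const card_ord -mulrnAl -[_ *+ q]mulr_natr mulVf ?mul1r//.
by rewrite pnatr_eq0 -lt0n.
Qed.

Let mu_far_iter s n : 0 <= s -> (mu (far s) <= mu (far (b%:R ^+ n * s)))%E.
Proof.
move=> s0; elim: n => [|n IHn]; first by rewrite expr0 mul1r.
by apply: (le_trans IHn); rewrite exprS -mulrA mu_far_le// mulr_ge0// exprn_ge0.
Qed.

Let far_le s s' : s <= s' -> far s' `<=` far s.
Proof. by move=> ss' x /farP h; apply/farP; case: h => h; [left|right]; lra. Qed.

Let mu_far s : 0 < s -> mu (far s) = 0%E.
Proof.
move=> s0; apply/eqP; rewrite eq_le measure_ge0 andbT.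
have e : \bigcap_n far (n%:R * s) = set0.
  apply/seteqP; split => // x h.
  have /archi_boundP : 0 <= `|x| / s by rewrite divr_ge0// ltW.
  set n := Num.bound _ => xn.
  move: xn; rewrite ltr_pdivrMr// => xn.
  have /farP := h n I; have := rho_ge0; move: xn; rewrite ltr_norml.
  by case/andP => ? ? ? []; lra.
have c : (mu \o (fun n => far (n%:R * s))) @ \oo --> mu (\bigcap_n far (n%:R * s)).
  apply: nonincreasing_cvg_mu => //.
  - exact: le_lt_trans (probability_le1 mu (measurable_far _)) (ltry _).
  - by rewrite e.
  - move=> m n mn; apply/subsetPset; apply: far_le.
    by rewrite ler_wpM2r ?(ltW s0)// ler_nat.
rewrite e measure0 in c; rewrite -(cvg_lim _ c)//.
apply: lime_ge; first by apply/cvg_ex; exists 0%E.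
apply: nearW => n /=; apply: (le_trans (mu_far_iter n (ltW s0))).
apply: le_measure; rewrite ?inE//; apply: far_le.
rewrite ler_wpM2r ?(ltW s0)// -natrX ler_nat ltnW// ltn_expl//.
Qed.

(** Each branch contracts the distance to $[0, \rho]$ by the factor $1/b$, so the
    mass beyond distance $s$ is at most the mass beyond $b^n s$ for every $n$. *)
Lemma support_null : mu (~` `[0, rho]%classic) = 0%E.
Proof.
have -> : ~` `[0, rho]%classic = \bigcup_n far n.+1%:R^-1.
  apply/seteqP; split => x.
    rewrite /= in_itv /= => /negP; rewrite negb_and -!ltNge => h.
    have [d d0 hd] : exists2 d : R, 0 < d & far d x.
      case/orP: h => h; [exists (- x / 2)|exists ((x - rho) / 2)]; try lra.
        by apply/farP; left; lra.
      by apply/farP; right; lra.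
    have /archi_boundP : 0 <= d^-1 by rewrite invr_ge0 ltW.
    set n := Num.bound _ => dn; exists n => //; apply: far_le hd.
    rewrite invf_ple ?posrE ?ltr0Sn//; apply: (le_trans (ltW dn)).
    by rewrite ler_nat.
  move=> [n _ /farP]; rewrite /= in_itv /= => h; apply/negP.
  have : 0 < n.+1%:R^-1 :> R by rewrite invr_gt0.
  move: (n.+1%:R^-1) h => d h d0.
  by rewrite negb_and -!ltNge; case: h => h; apply/orP; [left|right]; lra.
apply/eqP; rewrite eq_le measure_ge0 andbT.
apply: (le_trans (measure_sigma_subadditive _ _ _ (fun x h => h))) => //.
  by apply: bigcup_measurable => n _; exact: measurable_far.
by rewrite eseries0// => n _ _; apply: mu_far; rewrite invr_gt0.
Qed.

Lemma compactly_supported_mu : compactly_supported mu.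
Proof. by exists `[0, rho]%classic; split; [exact: segment_compact|exact: support_null]. Qed.

Lemma ae_support : {ae mu, forall x : T, 0 <= x <= rho}.
Proof.
exists (~` `[0, rho]%classic); split.
- by apply: measurableC; exact: measurable_itv.
- exact: support_null.
- by move=> x /= h; rewrite in_itv.
Qed.

Lemma Rintegral_ge_support (g : T -> R) M c : measurable_fun setT g ->
  (forall x, `|g x| <= M) -> (forall x, 0 <= x <= rho -> c <= g x) ->
  c <= \int[mu]_x g x.
Proof.
move=> mg gM cg.
(* outside the support, a null set, [g] may drop below [c] *)
pose h x := Num.max (g x) c.
have mh : measurable_fun setT h by apply: measurable_maxr.
have hM x : `|h x| <= M + `|c|.
  rewrite /h; have := gM x; have := normr_ge0 c; have := normr_ge0 (g x).
  by case: (leP (g x) c) => _; lra.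
have ih := prob_bounded_integrable mu mh hM.
have -> : \int[mu]_x g x = \int[mu]_x h x.
  congr fine; apply: ae_eq_integral => //; [exact/measurable_EFinP..|].
  apply: filterS ae_support => x /cg gx _; congr EFin.
  by rewrite /h max_l.
rewrite -[leLHS](_ : \int[mu]_(x in setT) c = c); last first.
  by rewrite Rintegral_cst// [X in fine X](probability_setT mu) mulr1.
apply: le_Rintegral => //.
  by apply: (@prob_bounded_integrable _ mu (fun=> c) `|c|).
by move=> x _; rewrite /h le_max lexx orbT.
Qed.

(** Centring the support at the origin by a phase, the integrand of the real
    part is a cosine of an angle of size at most $\pi \rho |t|$. *)
Lemma muhat_lower t : `|t| * rho <= 2^-1 ->
  0 <= cos (pi * rho * t) /\ cos (pi * rho * t) ^+ 2 <= sqn (muhat mu t).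
Proof.
move=> t2; have pi0 := pi_gt0 R; have r0 := rho_ge0.
have e : pi * (rho * `|t|) <= pi / 2 by rewrite ler_pM2l// mulrC.
have e0 : 0 <= pi * (rho * `|t|).
  exact: mulr_ge0 (pi_ge0 R) (mulr_ge0 r0 (normr_ge0 t)).
have en : cos (pi * rho * t) = cos (pi * (rho * `|t|)).
  rewrite -[in LHS]cos_norm -mulrA normrM ger0_norm ?pi_ge0//.
  by rewrite normrM [X in _ * (X * _)]ger0_norm.
have c0 : 0 <= cos (pi * rho * t).
  by rewrite en; apply: cos_ge0_pihalf; rewrite e andbT; lra.
split=> //.
have -> : sqn (muhat mu t) = sqn (cis (- (t * rho / 2)) * muhat mu t).
  by rewrite sqnM sqn_cis mul1r.
apply: (@le_trans _ _ (complex.Re (cis (- (t * rho / 2)) * muhat mu t) ^+ 2)); last first.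
  by rewrite /sqn lerDl sqr_ge0.
set z := (X in complex.Re X).
suff zc : cos (pi * rho * t) <= complex.Re z.
  by rewrite lerXn2r// nnegrE (le_trans c0).
have -> : z = cintegral mu (expfun t \o (fun x => x - rho / 2)).
  rewrite /z -cintegralZ; [|exact: cmeasurable_exp|exact: cbounded_exp].
  by congr cintegral; apply/funext => x /=; rewrite !expfunE -cisD; congr cis; ring.
rewrite /cintegral /=; apply: (@Rintegral_ge_support _ 1).
- have ms : measurable_fun setT (fun x : T => x - rho / 2 : T).
    by apply: measurable_funB.
  exact: (measurableT_comp (cmeasurable_exp t).1 ms).
- by move=> x; exact: cos_max.
move=> x /andP[x0 x1].
set y := (X in _ <= cos X); have -> : cos y = cos (pi * (`|t| * `|2 * x - rho|)).
  rewrite -cos_norm -(ger0_norm (pi_ge0 R)) -!normrM.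
  by congr (cos `|_|); rewrite /y; field.
have xr : `|2 * x - rho| <= rho by rewrite ler_norml; lra.
rewrite en; have -> : rho * `|t| = `|t| * rho by rewrite mulrC.
have h : pi * (`|t| * `|2 * x - rho|) <= pi * (`|t| * rho).
  by rewrite ler_pM2l// ler_wpM2l.
have h0 : 0 <= pi * (`|t| * `|2 * x - rho|).
  exact: mulr_ge0 (pi_ge0 R) (mulr_ge0 (normr_ge0 t) (normr_ge0 _)).
have et : pi * (`|t| * rho) <= pi / 2 by rewrite ler_pM2l.
by rewrite leNgt ltr_cos -?leNgt// in_itv /=; lra.
Qed.

End support.

(** * Zeros of the transform and orthogonal families *)

Section zeros.
Variables (R : realType) (b q : nat) (mu : probability (measurableTypeR R) R).
Hypotheses (q_gt0 : (0 < q)%N) (q_ltb : (q < b)%N) (hmu : is_mu_qb q b mu).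
Local Notation T := (measurableTypeR R).

Let b_gt0 : 0 < b%:R :> R.
Proof. by rewrite ltr0n (leq_ltn_trans _ q_ltb). Qed.

Let q_neq0 : q%:R != 0 :> R.
Proof. by rewrite pnatr_eq0 -lt0n. Qed.

Lemma L2inner_expfun l m : L2inner mu (expfun l) (expfun m) = muhat mu (l - m).
Proof.
rewrite /L2inner /muhat; congr cintegral; apply/funext => x.
by rewrite !expfunE mulrBl cisD cisN.
Qed.

(** The Fourier transform of the $n$-th approximation of $\mu_{q,b}$ by a uniform
    measure on $q^n$ points. *)
Definition muhatn (n : nat) (t : R) : R[i] :=
  \prod_(k < n) dmask q (t / b%:R ^+ k.+1).

Lemma muhatnS n t : muhatn n.+1 t = dmask q (t / b%:R) * muhatn n (t / b%:R).
Proof.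
rewrite /muhatn big_ord_recl expr1; congr (_ * _); apply: eq_bigr => k _.
by rewrite -mulrA -invfM -exprS.
Qed.

Lemma muhat_iter n t : muhat mu t = muhatn n t * muhat mu (t / b%:R ^+ n).
Proof.
elim: n t => [|n IHn] t; first by rewrite /muhatn big_ord0 mul1r expr0 divr1.
rewrite muhatnS (muhat_refine q_gt0 q_ltb hmu) IHn mulrA.
by rewrite -[t / b%:R / _]mulrA -invfM -exprS.
Qed.

Lemma muhat_neq0 t : `|t| * rho R b q < 2^-1 -> muhat mu t != 0.
Proof.
move=> t2; have [c0] := muhat_lower q_gt0 q_ltb hmu (ltW t2).
rewrite -sqn_eq0 => h; rewrite gt_eqF// (lt_le_trans _ h)// exprn_gt0//.
have pi0 := pi_gt0 R; have r0 := rho_ge0 R q_gt0 q_ltb.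
apply: cos_gt0_pihalf; rewrite -ltr_norml normrM (normrM pi).
rewrite (ger0_norm (pi_ge0 R)) (ger0_norm r0) -mulrA ltr_pM2l//.
by rewrite mulrC.
Qed.

Lemma cvg_pow_div (x e : R) : 0 < e -> exists N, forall n, (N <= n)%N ->
  `|x / b%:R ^+ n| < e.
Proof.
move=> e0; have b1 : 1 < b%:R :> R by rewrite ltr1n (leq_ltn_trans _ q_ltb).
have /archi_boundP : 0 <= `|x| / e by rewrite divr_ge0// ltW.
set N := Num.bound _ => hN; exists N => n Nn.
rewrite normrM normfV [X in _ / X]ger0_norm ?exprn_ge0 ?ltW//.
rewrite ltr_pdivrMr ?exprn_gt0// mulrC -ltr_pdivrMr//; apply: (lt_le_trans hN).
rewrite -natrX ler_nat (leq_trans Nn)// ltnW// ltn_expl//.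
by rewrite -(ltr1n R).
Qed.

(** The zeros of the infinite product are exactly those of its factors, since the
    tail tends to $\hat\mu(0) = 1$. *)
Lemma muhat_eq0P t : muhat mu t = 0 <->
  exists k, (t / b%:R ^+ k.+1 * q%:R \is a Num.int) &&
            (t / b%:R ^+ k.+1 \isn't a Num.int).
Proof.
split=> [h|[k hk]]; last first.
  rewrite (muhat_iter k.+1) /muhatn big_ord_recr /=.
  by rewrite -(dmask_eq0 q_gt0) in hk; rewrite (eqP hk) mulr0 mul0r.
have [n hn] := @cvg_pow_div t 2^-1 ltac:(by rewrite invr_gt0).
have r1 := rho_lt1 R q_gt0 q_ltb; have r0 := rho_ge0 R q_gt0 q_ltb.
have tn : muhat mu (t / b%:R ^+ n) != 0.
  apply: muhat_neq0; apply: le_lt_trans (hn n (leqnn n)).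
  by rewrite ler_piMr// ltW.
move/eqP: h; rewrite (muhat_iter n) mulf_eq0 (negbTE tn) orbF.
by rewrite prodf_seq_eq0 => /hasP[k _] /=; rewrite (dmask_eq0 q_gt0) => hk; exists k.
Qed.

Lemma int_divr (a : int) : (a%:~R / q%:R \is a @Num.int R) = (q %| a)%Z.
Proof.
apply/intrP/dvdzP => -[c hc]; exists c.
  apply: (@intr_inj R); rewrite rmorphM /= -hc.
  by rewrite -[(q : int)%:~R]/(q%:R : R) mulfVK.
by rewrite hc rmorphM /= -[(q : int)%:~R]/(q%:R : R) mulfK.
Qed.

(** If $\gcd(q,b) = 1$, then two elements of an orthogonal set whose differences
    to a base point have the same image in $\mathbb Z/q$ after scaling by $q$
    coincide: in $q(\lambda - \lambda') = b^k a$ the factor $b^k$ is invertible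
    modulo $q$. So an orthogonal set has at most $q$ elements. *)
Lemma finite_orthogonal (L : set R) : coprime q b ->
  (forall l m, L l -> L m -> l != m -> L2inner mu (expfun l) (expfun m) = 0) ->
  finite_set L.
Proof.
move=> cqb orth.
have [->|/set0P[l0 Ll0]] := eqVneq L set0; first exact: finite_set0.
have key l m : L l -> L m -> l != m -> exists k (a : int),
    q%:R * (l - m) = b%:R ^+ k.+1 * a%:~R /\ ~~ (q %| a)%Z.
  move=> Ll Lm lm; have := orth _ _ Ll Lm lm.
  rewrite L2inner_expfun => /muhat_eq0P[k /andP[/intrP[a ha] hn]].
  exists k, a; rewrite -ha; split.
    by rewrite mulrA [b%:R ^+ _ * _]mulrC mulfVK ?expf_neq0 ?gt_eqF// mulrC.
  by rewrite -int_divr -ha mulfK.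
pose N l := Num.floor (q%:R * (l - l0)).
have NE l : L l -> q%:R * (l - l0) = (N l)%:~R.
  move=> Ll; rewrite /N; have [->|ll0] := eqVneq l l0.
    by rewrite subrr mulr0 floor0.
  have [k [a [ha _]]] := key _ _ Ll Ll0 ll0.
  have : q%:R * (l - l0) \is a Num.int.
    by rewrite ha rpredM ?rpredX ?natr_int ?intr_int.
  by move/intrP => [c ->]; rewrite intrKfloor.
pose f l := `|(N l %% q)%Z|%N.
have finj : {in L &, injective f}.
  move=> l m /set_mem Ll /set_mem Lm hf; apply/eqP/negPn/negP => lm.
  have [k [a [ha /negP]]] := key _ _ Ll Lm lm; apply.
  have qz : (q : int) != 0 by rewrite eqz_nat -lt0n.
  have hf' : (N l %% q)%Z = (N m %% q)%Z.
    by have := modz_ge0 (N l) qz; have := modz_ge0 (N m) qz; move: hf; rewrite /f; lia.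
  have : (q %| N l - N m)%Z by rewrite -eqz_mod_dvd hf'.
  have -> : N l - N m = (b : int) ^+ k.+1 * a.
    apply: (@intr_inj R); rewrite rmorphB rmorphM rmorphXn /= -!NE// -[(b : int)%:~R]/(b%:R : R).
    by rewrite -ha; ring.
  by rewrite Gauss_dvdzr// coprimezE abszX coprimeXr.
have fin : finite_set (f @` L).
  apply: (@sub_finite_set _ _ `I_q); last exact: finite_II.
  move=> _ [l _ <-] /=; rewrite /f.
  have := ltz_pmod (N l) (_ : 0 < (q : int)); rewrite ltz_nat => /(_ q_gt0).
  have qz : (q : int) != 0 by rewrite eqz_nat -lt0n.
  by have := modz_ge0 (N l) qz; lia.
by rewrite -(eq_finite_set (inj_card_eq finj)).
Qed.

(** If $d = \gcd(q, b) > 1$, the numbers $b^n / d$, $n \ge 1$, differ by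
    $b^m (b^{n - m} - 1) / d$, and $d$, which divides $b$, cannot divide
    $b^{n - m} - 1$. *)
Lemma infinite_orthogonal : (1 < gcdn q b)%N ->
  infinitely_many_orthogonal_exponentials mu.
Proof.
set d := gcdn q b => d1.
have dR : d%:R != 0 :> R by rewrite pnatr_eq0 -lt0n ltnW.
have b1 : (1 < b)%N by apply: leq_ltn_trans q_ltb.
pose f n : R := b%:R ^+ n.+1 / d%:R.
have finj : injective f.
  move=> n m /(divIf dR) h; apply/eqP; rewrite -eqSS -(eqn_exp2l _ _ b1).
  by rewrite -(eqr_nat R) !natrX h.
exists (range f); split.
  rewrite (eq_finite_set (inj_card_eq (in2W finj))).
  exact: infinite_nat.
have half m n : (m < n)%N -> muhat mu (f n - f m) = 0.
  move=> mn; apply/muhat_eq0P; exists m.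
  have -> : (f n - f m) / b%:R ^+ m.+1 = (b%:R ^+ (n - m) - 1) / d%:R.
    rewrite /f (_ : n.+1 = (n - m) + m.+1)%N; last by rewrite addnS subnK// ltnW.
    by rewrite exprD; field; rewrite dR expf_neq0// gt_eqF.
  have [dq db] : (d %| q)%N /\ (d %| b)%N by rewrite dvdn_gcdl dvdn_gcdr.
  have nm : (0 < n - m)%N by rewrite subn_gt0.
  apply/andP; split.
    rewrite mulrAC -mulrA -{1}(divnK dq) natrM mulfK//.
    by rewrite rpredM ?natr_int// rpredB ?rpredX ?natr_int// rpred1.
  apply/negP => /intrP[c hc].
  have {hc} hc : (b%:R ^+ (n - m) - 1 : R) = c%:~R * d%:R.
    by rewrite -hc mulfVK.
  have e : (b : int) ^+ (n - m) - 1 = c * d.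
    by apply: (@intr_inj R); rewrite rmorphB rmorphM rmorphXn /= -[(b : int)%:~R]/(b%:R : R) hc.
  have /dvdzP[c' hc'] : ((d : int) %| (b : int) ^+ (n - m))%Z.
    by rewrite dvdz_exp.
  have : ((d : int) %| 1)%Z.
    apply/dvdzP; exists (c' - c); rewrite mulrBl -e -hc'; ring.
  by rewrite dvdz1 /=; case: (d) d1 => [|[|]].
move=> _ _ [n _ <-] [m _ <-] nm; rewrite L2inner_expfun.
have [mn|mn|mn] := ltngtP m n; first exact: half.
  have /muhat_eq0P[k hk] := half _ _ mn.
  by apply/muhat_eq0P; exists k; rewrite -opprB !mulNr !rpredN.
by rewrite mn eqxx in nm.
Qed.

End zeros.

(** * The candidate spectrum *)

Section spectrum.
Variables (R : realType) (b q : nat) (mu : probability (measurableTypeR R) R).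
Hypotheses (q_gt0 : (0 < q)%N) (q_ltb : (q < b)%N) (hmu : is_mu_qb q b mu).
Hypothesis q_dvd_b : (q %| b)%N.
Local Notation T := (measurableTypeR R).

Local Notation r := (b %/ q)%N.

Let bE : b = (r * q)%N.
Proof. by rewrite divnK. Qed.

Let bR : b%:R = r%:R * q%:R :> R.
Proof. by rewrite -natrM -bE. Qed.

Let r_gt1 : (1 < r)%N.
Proof. by rewrite ltn_divRL// mul1n. Qed.

Let b_gt0 : 0 < b%:R :> R.
Proof. by rewrite ltr0n (leq_ltn_trans _ q_ltb). Qed.

Let b_gt1 : 1 < b%:R :> R.
Proof. by rewrite ltr1n (leq_ltn_trans _ q_ltb). Qed.

Let q_neq0 : q%:R != 0 :> R.
Proof. by rewrite pnatr_eq0 -lt0n. Qed.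

(** The integers $\frac bq \sum_{k<n} b^k d_k$ with digits $d_k < q$, the digit
    $d_0$ being read off first. *)
Fixpoint Lam (n : nat) : seq nat :=
  if n is n'.+1 then [seq r * d + b * l | d <- iota 0 q, l <- Lam n']%N else [:: 0%N].

Lemma LamS n l : reflect (exists d l', [/\ (d < q)%N, l' \in Lam n & l = r * d + b * l'])%N
  (l \in Lam n.+1).
Proof.
apply: (iffP allpairsP) => [[[d l'] /= [+ hl' ->]]|[d [l' [dq hl' ->]]]].
  by rewrite mem_iota /= add0n => dq; exists d, l'.
by exists (d, l'); rewrite /= mem_iota.
Qed.

Lemma uniq_Lam n : uniq (Lam n).
Proof.
elim: n => [//|n IHn]; apply: allpairs_uniq => //; first exact: iota_uniq.
move=> [d l] [d' l'] /allpairsP[[d1 l1] [/= + _ [-> ->]]].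
rewrite mem_iota add0n /= => dq.
move=> /allpairsP[[d2 l2] [/= + _ [-> ->]]]; rewrite mem_iota add0n /= => dq'.
have e x y : (r * x + b * y = r * (x + q * y))%N by rewrite mulnDr mulnA -bE.
have r0 : (0 < r)%N by apply: ltnW.
rewrite !e => /eqP; rewrite eqn_pmul2l// => /eqP h.
have hd : d1 = d2.
  by have := congr1 (modn^~ q) h; rewrite /= !(addnC _ (q * _)%N) !(mulnC q) !modnMDl !modn_small.
by move: h; rewrite hd => /addnI/eqP; rewrite eqn_pmul2l// => /eqP ->.
Qed.

Lemma sub_LamS n : {subset Lam n <= Lam n.+1}.
Proof.
elim: n => [l|n IHn l].
  by rewrite inE => /eqP ->; apply/LamS; exists 0%N, 0%N; rewrite inE !muln0.
by move/LamS => [d [l' [dq /IHn hl' ->]]]; apply/LamS; exists d, l'.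
Qed.

Lemma sub_Lam m n : (m <= n)%N -> {subset Lam m <= Lam n}.
Proof.
by move=> /subnK <-; elim: (n - m)%N => [//|k IHk] l /IHk /sub_LamS.
Qed.

(** All digits equal to $q - 1$ give the largest element. As $b/q \ge 2$, the
    coefficient of $b^n$ is less than $1$: rescaled by $b^n$, level [n] stays inside
    the zero-free interval around $0$. *)
Lemma Lam_bound n l : l \in Lam n ->
  l%:R <= (b%:R - r%:R) / (b%:R - 1) * (b%:R ^+ n - 1) :> R.
Proof.
have b1 : 0 < b%:R - 1 :> R by rewrite subr_gt0.
have r1 : 1 < r%:R :> R by rewrite ltr1n.
set K := _ / _; have KE : K * (b%:R - 1) = b%:R - r%:R by rewrite mulfVK// gt_eqF.
elim: n l => [l|n IHn l]; first by rewrite inE => /eqP ->; rewrite expr0 subrr mulr0.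
move=> /LamS[d [l' [dq /IHn hl' ->]]]; rewrite natrD !natrM exprS.
have : b%:R * l'%:R <= b%:R * (K * (b%:R ^+ n - 1)) by rewrite ler_pM2l.
have : r%:R * d%:R <= r%:R * (q%:R - 1) :> R.
  by rewrite ler_pM2l ?(lt_trans _ r1)// lerBrDr natr1 ler_nat.
rewrite mulrBr mulr1 -bR -KE; move: (b%:R ^+ n) => bn; nra.
Qed.

(** Two distinct points of the spectrum have a lowest digit in which they
    differ, and $q$ divides all the higher-order terms. *)
Lemma muhat_Lam_eq0 n l m : l \in Lam n -> m \in Lam n -> l != m ->
  muhat mu (l%:R - m%:R) = 0.
Proof.
elim: n l m => [l m|n IHn l m]; first by rewrite !inE => /eqP -> /eqP ->.
move=> /LamS[d [l' [dq hl ->]]] /LamS[e [m' [eq hm ->]]] lm.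
rewrite (muhat_refine q_gt0 q_ltb hmu).
have -> : ((r * d + b * l')%:R - (r * e + b * m')%:R) / b%:R =
          (d%:R - e%:R) / q%:R + (l'%:R - m'%:R) :> R.
  rewrite !natrD !natrM bR; field.
  by rewrite q_neq0 pnatr_eq0 -lt0n (ltnW r_gt1).
have [de|de] := eqVneq d e.
  rewrite de subrr mul0r add0r IHn ?mulr0//.
  by apply: contra lm => /eqP ->; rewrite de.
suff /eqP -> : dmask q ((d%:R - e%:R) / q%:R + (l'%:R - m'%:R)) == 0 :> R[i] by rewrite mul0r.
have i1 : (l'%:R - m'%:R : R) \is a Num.int by rewrite rpredB ?natr_int.
rewrite dmaskD_int// (dmask_eq0 q_gt0) mulfVK// rpredB ?natr_int//=.
have -> : (d%:R - e%:R : R) = ((d : int) - (e : int))%:~R by rewrite rmorphB.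
rewrite int_divr//; apply/negP => /dvdzP[c hc].
have [c0|c0|c0] := ltgtP c 0; [nia|nia|].
by rewrite c0 in hc; move: de; lia.
Qed.

(** The higher digits contribute integers to $(t - \lambda)/b$, and the mask has
    period $1$: the factor of the lowest digit can be summed by Parseval on
    $\mathbb Z/q$ and the others by induction. *)
Lemma sum_sqn_muhatn n (t : R) : \sum_(l <- Lam n) sqn (muhatn b q n (t - l%:R)) = 1.
Proof.
elim: n t => [|n IHn] t.
  by rewrite big_seq1 /muhatn big_ord0 sqn_real expr1n.
rewrite /= big_allpairs_dep /=.
rewrite -[RHS](sum_sqn_dmask q_gt0 (t / b%:R)).
rewrite -(big_mkord xpredT (fun d => sqn (dmask q (t / b%:R - d%:R / q%:R)))).
rewrite /index_iota subn0; apply: eq_bigr => d _.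
rewrite -[RHS]mulr1 -[X in _ = _ * X](IHn (t / b%:R - d%:R / q%:R)) mulr_sumr.
apply: eq_bigr => l _; rewrite muhatnS sqnM.
have -> : (t - (r * d + b * l)%:R) / b%:R = (t / b%:R - d%:R / q%:R) - l%:R :> R.
  rewrite natrD !natrM bR; field.
  by rewrite q_neq0 pnatr_eq0 -lt0n (ltnW r_gt1).
by rewrite dmaskD_int// rpredN natr_int.
Qed.

End spectrum.

(** * Bessel's identity and approximation of every exponential *)

Section mean_square.
Variables (R : realType) (mu : probability (measurableTypeR R) R).
Local Notation T := (measurableTypeR R).
Implicit Types f g : T -> R[i].

Definition msq f : \bar R := (\int[mu]_x (sqn (f x))%:E)%E.

Lemma msq_ge0 f : (0 <= msq f)%E.
Proof. by apply: integral_ge0 => x _; rewrite lee_fin sqn_ge0. Qed.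

Lemma cmeasurable_conj f : cmeasurable f -> cmeasurable (fun x => conjc (f x)).
Proof.
move=> [mf1 mf2]; split.
  by rewrite (_ : (fun x => _) = (fun x => complex.Re (f x)))//; apply/funext => x; case: (f x).
rewrite (_ : (fun x => _) = (fun x => - complex.Im (f x))); first exact: measurable_funN.
by apply/funext => x; case: (f x).
Qed.

Lemma sqn_conj (z : R[i]) : sqn (conjc z) = sqn z.
Proof. by case: z => x y; rewrite /sqn /= sqrrN. Qed.

Lemma cbounded_conj f : cbounded f -> cbounded (fun x => conjc (f x)).
Proof. by move=> [M hM]; exists M => x; rewrite sqn_conj. Qed.

Lemma msq_cintegral f : cmeasurable f -> cbounded f ->
  msq f = (complex.Re (cintegral mu (fun x => f x * conjc (f x))))%:E.
Proof.
move=> mf bf; have [ig _] := cint_integrable mu (cmeasurableM mf (cmeasurable_conj mf))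
  (cboundedM bf (cbounded_conj bf)).
rewrite /cintegral /= fineK; last exact: integrable_fin_num.
by apply: eq_integral => x _; rewrite mul_conjC.
Qed.

Lemma muhatN t : muhat mu (- t) = conjc (muhat mu t).
Proof.
rewrite /muhat /cintegral /=; apply: complex_ext => /=.
  by apply: eq_Rintegral => x _; rewrite mulrN mulNr cosN.
have [_ i2] := cint_integrable mu (cmeasurable_exp t) (cbounded_exp t).
rewrite -mulN1r -RintegralZl//.
by apply: eq_Rintegral => x _; rewrite mulrN mulNr sinN mulN1r.
Qed.

(** Bessel's identity for the projection of one exponential on finitely many
    orthogonal ones. *)
Lemma bessel (s : seq R) xi : uniq s ->
  (forall l m, l \in s -> m \in s -> l != m -> muhat mu (l - m) = 0) ->
  msq (fun x => expfun xi x - \sum_(l <- s) muhat mu (xi - l) * expfun l x) =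
  (1 - \sum_(l <- s) sqn (muhat mu (xi - l)))%:E.
Proof.
move=> us orth; set f := fun x => _.
have mE t : cmeasurable (expfun t : T -> R[i]) by exact: cmeasurable_exp.
have bE t : cbounded (expfun t : T -> R[i]) by exact: cbounded_exp.
have mcE c t : cmeasurable (fun x : T => c * expfun t x).
  by apply: cmeasurableM => //; exact: cmeasurable_cst.
have bcE c t : cbounded (fun x : T => c * expfun t x).
  by apply: cboundedM => //; exact: cbounded_cst.
have mf : cmeasurable f by apply: cmeasurableB => //; exact: cmeasurable_sum.
have bf : cbounded f.
  rewrite /f; under eq_fun do rewrite -mulN1r.
  by apply: cboundedD => //; apply: cboundedM; [exact: cbounded_cst|exact: cbounded_sum].
rewrite msq_cintegral//; congr EFin.
have inner m : cintegral mu (fun x => f x * conjc (expfun m x)) =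
    muhat mu (xi - m) - \sum_(l <- s) muhat mu (xi - l) * muhat mu (l - m).
  have -> : (fun x => f x * conjc (expfun m x)) = (fun x => expfun (xi - m) x +
     \sum_(l <- s) (- muhat mu (xi - l)) * expfun (l - m) x).
    apply/funext => x; rewrite /f mulrBl mulr_suml -sumrN; congr (_ + _).
      by rewrite !expfunE -cisN -cisD mulrBl.
    apply: eq_bigr => l _; rewrite !expfunE -mulrA -cisN -cisD mulNr.
    by rewrite -mulrBl.
  rewrite cintegralD//; [|exact: cmeasurable_sum|exact: cbounded_sum].
  rewrite cintegral_sum// -sumrN; congr (_ + _); apply: eq_bigr => l _.
  by rewrite cintegralZ// mulNr.
have inner0 m : m \in s -> cintegral mu (fun x => f x * conjc (expfun m x)) = 0.
  move=> ms; rewrite inner (bigD1_seq m)//= subrr muhat0 mulr1 big_seq_cond big1 ?addr0 ?subrr//.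
  by move=> l /andP[ls lm]; rewrite (orth l m)// mulr0.
have -> : (fun x => f x * conjc (f x)) = (fun x => f x * conjc (expfun xi x) +
    \sum_(m <- s) (- conjc (muhat mu (xi - m))) * (f x * conjc (expfun m x))).
  apply/funext => x; rewrite [in X in _ * X]/f -[X in conjc X]/(_ + - _).
  have -> (z w : R[i]) : conjc (z - w) = conjc z - conjc w by exact: rmorphB.
  rewrite mulrBr; congr (_ + _); rewrite conjc_sum mulr_sumr -sumrN.
  by apply: eq_bigr => l _; rewrite conjcM mulNr mulrCA.
have mfE m : cmeasurable (fun x => f x * conjc (expfun m x)).
  by apply: cmeasurableM => //; exact: cmeasurable_conj.
have bfE m : cbounded (fun x => f x * conjc (expfun m x)).
  by apply: cboundedM => //; exact: cbounded_conj.
have mcfE c m : cmeasurable (fun x => c * (f x * conjc (expfun m x))).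
  by apply: cmeasurableM => //; exact: cmeasurable_cst.
have bcfE c m : cbounded (fun x => c * (f x * conjc (expfun m x))).
  by apply: cboundedM => //; exact: cbounded_cst.
rewrite cintegralD//; [|exact: cmeasurable_sum|exact: cbounded_sum].
rewrite cintegral_sum// [X in _ + X]big_seq big1 ?addr0; last first.
  by move=> m ms; rewrite cintegralZ// inner0// mulr0.
rewrite inner subrr muhat0.
rewrite (eq_bigr (fun l => (sqn (muhat mu (xi - l)))%:C)) => [|l _]; last first.
  by rewrite -[l - xi]opprB muhatN mul_conjC.
by rewrite -rmorph_sum.
Qed.

End mean_square.

Section exponential_approximation.
Variables (R : realType) (b q : nat) (mu : probability (measurableTypeR R) R).
Hypotheses (q_gt0 : (0 < q)%N) (q_ltb : (q < b)%N) (hmu : is_mu_qb q b mu).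
Hypothesis q_dvd_b : (q %| b)%N.
Local Notation T := (measurableTypeR R).
Local Notation Lam := (Lam b q).
Local Notation rho := (rho R b q).

Let b_gt0 : 0 < b%:R :> R.
Proof. by rewrite ltr0n (leq_ltn_trans _ q_ltb). Qed.

Let b_gt1 : 1 < b%:R :> R.
Proof. by rewrite ltr1n (leq_ltn_trans _ q_ltb). Qed.

Let r0 : 0 <= rho.
Proof. exact: rho_ge0. Qed.

Let rho_lt_half : rho < 2^-1.
Proof.
(* a proper divisor [q] of [b] is at most [b / 2] *)
have q2 : (q * 2 <= b)%N.
  by rewrite mulnC -leq_divRL// ltn_divRL// mul1n.
have : q%:R * 2 <= b%:R :> R by rewrite -natrM ler_nat.
by rewrite /rho ltr_pdivrMr ?subr_gt0// => h; have := b_gt1; lra.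
Qed.

(** A lower bound for $|\hat\mu(t)|^2$ that is uniform in $|t| \le x \le 1$. *)
Definition weight (x : R) : R := cos (pi * (rho * x)) ^+ 2.

Let ang_bound x : 0 <= x <= 1 -> 0 <= pi * (rho * x) < pi / 2.
Proof.
move=> /andP[x0 x1]; rewrite (mulr_ge0 (pi_ge0 R) (mulr_ge0 r0 x0)) /=.
rewrite ltr_pM2l ?pi_gt0//; apply: le_lt_trans rho_lt_half.
by rewrite ler_piMr.
Qed.

Lemma weight_gt0 x : 0 <= x <= 1 -> 0 < weight x.
Proof.
move=> /ang_bound /andP[h0 h1]; rewrite exprn_gt0//; apply: cos_gt0_pihalf.
by rewrite h1 andbT (lt_le_trans _ h0)// oppr_lt0 divr_gt0// pi_gt0.
Qed.

Lemma weight_le_sqn t x : `|t| <= x -> x <= 1 -> weight x <= sqn (muhat mu t).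
Proof.
move=> tx x1; have x0 := le_trans (normr_ge0 t) tx.
have t2 : `|t| * rho <= 2^-1.
  apply: le_trans (ltW rho_lt_half); rewrite ler_piMl//.
  exact: le_trans tx x1.
have [_] := muhat_lower q_gt0 q_ltb hmu t2; apply: le_trans.
have -> : cos (pi * rho * t) = cos (pi * (rho * `|t|)).
  rewrite -[in LHS]cos_norm -mulrA normrM ger0_norm ?pi_ge0//.
  by rewrite normrM [X in _ * (X * _)]ger0_norm.
have /ang_bound/andP[a0 a1] : 0 <= `|t| <= 1 by rewrite normr_ge0 (le_trans tx x1).
have /ang_bound/andP[c0 c1] : 0 <= x <= 1 by rewrite x0 x1.
have p2 : pi / 2 < pi :> R by have := pi_gt0 R; lra.
have cc : cos (pi * (rho * x)) <= cos (pi * (rho * `|t|)).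
  have h : pi * (rho * `|t|) <= pi * (rho * x) by rewrite ler_pM2l ?pi_gt0// ler_wpM2l.
  by rewrite leNgt ltr_cos -?leNgt// in_itv /=; lra.
have cx : 0 <= cos (pi * (rho * x)).
  by apply: cos_ge0_pihalf; rewrite (ltW c1) andbT; have := pi_gt0 R; lra.
by rewrite /weight lerXn2r// nnegrE (le_trans cx).
Qed.

Lemma weight_near1 e : 0 < e -> exists x, [/\ 0 < x, x <= 1 & 1 - e <= weight x].
Proof.
move=> e0.
have cw : {for 0, continuous weight}.
  rewrite /weight /=.
  apply: (@continuous_comp _ _ _ (fun x => cos (pi * (rho * x)))
    (fun y => y ^+ 2)); last exact: exprn_continuous.
  apply: (@continuous_comp _ _ _ (fun x => pi * (rho * x)) (@cos R)); last exact: continuous_cos.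
  by apply: cvgM; [exact: cvg_cst|apply: cvgM; [exact: cvg_cst|exact: cvg_id]].
have w0 : weight 0 = 1 by rewrite /weight !mulr0 cos0 expr1n.
have /cvgrPdist_le /(_ e e0) := cw; rewrite w0.
move=> /nbhs_ballP[d /= d0 hd].
exists (Num.min 1 (d / 2)); split.
- by rewrite lt_min ltr01 divr_gt0.
- by rewrite ge_min lexx.
have : `|1 - weight (Num.min 1 (d / 2))| <= e.
  apply: hd; rewrite /ball /= sub0r normrN ger0_norm; last by rewrite le_min ler01 divr_ge0// ltW.
  by rewrite gt_min; apply/orP; right; rewrite ltr_pdivrMr// ltr_pMr// ltr1n.
by rewrite ler_norml => /andP[_]; lra.
Qed.

Section tail.
Variable xi : R.

Let a (l : nat) : R := sqn (muhat mu (xi - l%:R)).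
Let S (n : nat) : R := \sum_(l <- Lam n) a l.

Let bessel_Lam n :
  msq mu (fun x => expfun xi x -
    \sum_(l <- [seq l%:R | l <- Lam n]) muhat mu (xi - l) * expfun l x) =
  (1 - S n)%:E.
Proof.
rewrite bessel ?big_map//.
  by rewrite map_inj_uniq ?uniq_Lam// => x y /eqP; rewrite eqr_nat => /eqP.
move=> _ _ /mapP[l hl ->] /mapP[m hm ->] lm.
by apply: (muhat_Lam_eq0 q_gt0 q_ltb hmu q_dvd_b hl hm); apply: contra lm => /eqP ->.
Qed.

Let S_le1 n : S n <= 1.
Proof. by have := msq_ge0 mu _; rewrite -subr_ge0 -lee_fin -bessel_Lam; apply. Qed.

Let Lam_perm N n : (N <= n)%N -> perm_eq [seq l <- Lam n | l \in Lam N] (Lam N).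
Proof.
move=> Nn; apply: uniq_perm; rewrite ?filter_uniq ?uniq_Lam// => l.
rewrite mem_filter andb_idr// => h; exact: (sub_Lam q_gt0 Nn h).
Qed.

Let S_split N n (F : nat -> R) : (N <= n)%N ->
  \sum_(l <- Lam n) F l =
  \sum_(l <- Lam N) F l + \sum_(l <- Lam n | l \notin Lam N) F l.
Proof.
move=> Nn; rewrite (bigID (fun l => l \in Lam N)) /=; congr (_ + _).
by rewrite -big_filter; apply: perm_big; exact: Lam_perm.
Qed.

(* for large [n] every frequency of level [n], rescaled by [b ^ n], lies where
   the transform is bounded below *)
Let level_bound : exists n1, forall n l, (n1 <= n)%N -> l \in Lam n ->
  `|(xi - l%:R) / b%:R ^+ n| <= 1.
Proof.
set K : R := (b%:R - (b %/ q)%:R) / (b%:R - 1).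
have b1 : 0 < b%:R - 1 :> R by rewrite subr_gt0.
have K1 : K < 1.
  by rewrite ltr_pdivrMr// mul1r ltrD2l ltrN2 ltr1n ltn_divRL// mul1n.
have K0 : 0 <= K by rewrite divr_ge0 ?(ltW b1)// subr_ge0 ler_nat leq_div.
have K1' : 0 < 1 - K by rewrite subr_gt0.
have [n1 h1] := cvg_pow_div q_gt0 q_ltb xi K1'.
exists n1 => n l nn1 hl; have bn : 0 < b%:R ^+ n :> R by rewrite exprn_gt0.
have lK : l%:R / b%:R ^+ n <= K.
  rewrite ler_pdivrMr//; apply: le_trans (Lam_bound R q_gt0 q_ltb q_dvd_b hl) _.
  by rewrite ler_wpM2l// gerBl.
have l0 : 0 <= l%:R / b%:R ^+ n :> R by rewrite divr_ge0// ltW.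
have := h1 n nn1; rewrite mulrBl; move: (xi / _) (l%:R / _) lK l0 => x y yK y0.
by rewrite ltr_norml ler_norml; lra.
Qed.

(** The transform of $\mu$ factors as that of its $n$-th approximation times a
    factor that is bounded below on all of level $n$ and tends to $1$ at each fixed
    frequency. The masses of the approximations are $1$, and dominated convergence
    for sums carries this over to $\mu$. *)
Lemma exp_approx (eps : R) : 0 < eps -> exists N,
  (msq mu (fun x => (expfun xi x -
    \sum_(l <- [seq l%:R | l <- Lam N]) muhat mu (xi - l) * expfun l x)%R) < eps%:E)%E.
Proof.
move=> e0; suff [N hN] : exists N, 1 - eps < S N.
  by exists N; rewrite bessel_Lam lte_fin ltrBlDr addrC -ltrBlDr.
(* the near and the far frequencies each cost a factor [1 - e] *)
pose e := Num.min eps 1 / 4.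
have e_gt0 : 0 < e by rewrite divr_gt0// lt_min e0 ltr01.
have e_le : 4 * e <= eps by rewrite mulrC divfK// ge_min lexx.
have e_le1 : 4 * e <= 1 by rewrite mulrC divfK// ge_min lexx orbT.
have c_gt0 : 0 < weight 1 by apply: weight_gt0; rewrite ler01 lexx.
have [x [x0 x1 hx]] := weight_near1 e_gt0.
have wx : 0 < weight x by lra.
have [N hN] : exists N, forall n, S n - S N <= weight 1 * e.
  have hs : has_sup (range S).
    split; first by exists (S 0%N), 0%N.
    by exists 1 => _ [n _ <-].
  have [_ [N _ <-] hN] := sup_adherent (mulr_gt0 c_gt0 e_gt0) hs.
  exists N => n; have : S n <= sup (range S) by apply: sup_upper_bound => //; exists n.
  by move: hN; lra.
exists N.
have [n1 h1] := level_bound.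
pose X : R := `|xi| + \sum_(l <- Lam N) l%:R.
have [n2 h2] := cvg_pow_div q_gt0 q_ltb X x0.
pose n := maxn N (maxn n1 n2).
have Nn : (N <= n)%N by rewrite leq_maxl.
have n1n : (n1 <= n)%N by rewrite leq_max leq_maxl orbT.
have n2n : (n2 <= n)%N by rewrite leq_max leq_maxr orbT.
have bn : 0 < b%:R ^+ n :> R by rewrite exprn_gt0.
pose p l : R := sqn (muhatn b q n (xi - l%:R)).
have p0 l : 0 <= p l by exact: sqn_ge0.
have ap l : a l = p l * sqn (muhat mu ((xi - l%:R) / b%:R ^+ n)).
  by rewrite /a (muhat_iter q_gt0 q_ltb hmu n) sqnM.
have near l : l \in Lam N -> p l <= a l / weight x.
  move=> hl; rewrite ler_pdivlMr// ap ler_wpM2l//; apply: weight_le_sqn => //.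
  apply: le_trans (ltW (h2 n n2n)); rewrite !normrM ler_wpM2r//.
  apply: le_trans (ler_normB _ _) _; rewrite [leRHS]ger0_norm; last first.
    by rewrite addr_ge0// sumr_ge0.
  rewrite lerD2l ger0_norm// (bigD1_seq l)//= ?uniq_Lam// lerDl sumr_ge0//.
have far l : l \in Lam n -> p l <= a l / weight 1.
  move=> hl; rewrite ler_pdivlMr// ap ler_wpM2l//; apply: weight_le_sqn => //.
  exact: h1.
have := sum_sqn_muhatn q_gt0 q_ltb q_dvd_b n xi.
rewrite (S_split _ Nn).
have sN : \sum_(l <- Lam N) p l <= S N / weight x.
  by rewrite /S mulr_suml big_seq [leRHS]big_seq; apply: ler_sum => l /near.
have sn : \sum_(l <- Lam n | l \notin Lam N) p l <= e.
  apply: (@le_trans _ _ (\sum_(l <- Lam n | l \notin Lam N) a l / weight 1)).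
    rewrite big_seq_cond [leRHS]big_seq_cond; apply: ler_sum => l /andP[hl _].
    exact: far.
  rewrite -mulr_suml ler_pdivrMr// mulrC; apply: le_trans (hN n).
  by rewrite /S (S_split _ Nn) addrAC subrr add0r.
rewrite -/p => h.
have h' : 1 - e <= S N / weight x by rewrite -h; lra.
move: h'; rewrite ler_pdivlMr// => h'.
have : (1 - e) * (1 - e) <= (1 - e) * weight x by rewrite ler_pM2l//; lra.
by nra.
Qed.

End tail.

End exponential_approximation.

(** * Closed spans of exponentials in mean square *)

Section density.
Variables (R : realType) (mu : probability (measurableTypeR R) R) (L : set R).
Local Notation T := (measurableTypeR R).
Implicit Types f g h : T -> R[i].
Local Notation msq := (msq mu).

Let measurable_sqnE f : cmeasurable f -> measurable_fun setT (fun x => (sqn (f x))%:E).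
Proof. by move=> mf; apply/measurable_EFinP; exact: measurable_sqn. Qed.

Lemma msq_mul_le M f g : cmeasurable f -> cmeasurable g -> (forall x, sqn (g x) <= M) ->
  (msq (fun x => g x * f x)%R <= M%:E * msq f)%E.
Proof.
move=> mf mg gM; rewrite /msq.
have M0 : 0 <= M by apply: le_trans (gM 0); exact: sqn_ge0.
rewrite -ge0_integralZl//; [|exact: measurable_sqnE|by move=> x _; rewrite lee_fin sqn_ge0].
apply: ge0_le_integral => //.
- by move=> x _; rewrite lee_fin sqn_ge0.
- by apply: measurable_sqnE; exact: cmeasurableM.
- by apply: emeasurable_funM => //; exact: measurable_sqnE.
- by move=> x _; rewrite sqnM -EFinM lee_fin ler_wpM2r// sqn_ge0.
Qed.

Lemma msqD_le f g : cmeasurable f -> cmeasurable g ->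
  (msq (fun x => f x + g x)%R <= 2%:E * msq f + 2%:E * msq g)%E.
Proof.
move=> mf mg; rewrite /msq.
have mfE := measurable_sqnE mf; have mgE := measurable_sqnE mg.
have f0 x : setT x -> (0 <= (sqn (f x))%:E)%E by rewrite lee_fin sqn_ge0.
have g0 x : setT x -> (0 <= (sqn (g x))%:E)%E by rewrite lee_fin sqn_ge0.
rewrite -!ge0_integralZl// -ge0_integralD//; first last.
- by apply: emeasurable_funM.
- by move=> x _; rewrite -EFinM lee_fin mulr_ge0// sqn_ge0.
- by apply: emeasurable_funM.
- by move=> x _; rewrite -EFinM lee_fin mulr_ge0// sqn_ge0.
apply: ge0_le_integral => //.
- by move=> x _; rewrite lee_fin sqn_ge0.
- by apply: measurable_sqnE; exact: cmeasurableD.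
- by apply: emeasurable_funD; apply: emeasurable_funM.
- by move=> x _; rewrite -!EFinM -EFinD lee_fin sqnD.
Qed.

Definition trig (p : T -> R[i]) : Prop := exists s : seq (R * R[i]),
  (forall u, u \in s -> L u.1) /\ forall x, p x = \sum_(u <- s) u.2 * expfun u.1 x.

Lemma trigD p p' : trig p -> trig p' -> trig (fun x => p x + p' x).
Proof.
move=> [s [Ls hs]] [s' [Ls' hs']]; exists (s ++ s'); split.
  by move=> u; rewrite mem_cat => /orP[/Ls|/Ls'].
by move=> x; rewrite hs hs' big_cat.
Qed.

Lemma trigZ c p : trig p -> trig (fun x => c * p x).
Proof.
move=> [s [Ls hs]]; exists [seq (u.1, c * u.2) | u <- s]; split.
  by move=> _ /mapP[u us ->] /=; exact: (Ls u us).
by move=> x; rewrite hs big_map mulr_sumr; apply: eq_bigr => u _; rewrite mulrA.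
Qed.

Lemma trig_bounded p : trig p -> cmeasurable p /\ cbounded p.
Proof.
move=> [s [_ hs]]; rewrite (_ : p = fun x => \sum_(u <- s) u.2 * expfun u.1 x);
  last by apply/funext.
split.
  apply: cmeasurable_sum => u; apply: cmeasurableM; last exact: cmeasurable_exp.
  exact: cmeasurable_cst.
apply: cbounded_sum => u; apply: cboundedM; last exact: cbounded_exp.
exact: cbounded_cst.
Qed.

(** The closed linear span in $L^2(\mu)$ of the exponentials with frequency
    in [L]. *)
Definition spanned f : Prop := cmeasurable f /\
  forall eps : R, 0 < eps -> exists2 p, trig p & (msq (fun x => f x - p x)%R < eps%:E)%E.

(** Dividing by [M + 1] instead of [M] covers [M = 0]. *)
Lemma msq_scale_lt f M (eps : R) : 0 < eps -> 0 <= M -> (msq f < (eps / (M + 1))%:E)%E ->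
  (M%:E * msq f < eps%:E)%E.
Proof.
move=> e0 M0 h; have M1 : 0 < M + 1 by lra.
have f0 := msq_ge0 mu f.
have ff : msq f \is a fin_num by rewrite ge0_fin_numE// (lt_trans h) ?ltry.
rewrite -(fineK ff) in h f0 *; rewrite -EFinM !lte_fin lee_fin in h f0 *.
by move: h; rewrite ltr_pdivlMr//; nra.
Qed.

Lemma spanned_lim f : cmeasurable f ->
  (forall eps : R, 0 < eps -> exists2 g, spanned g & (msq (fun x => f x - g x)%R < eps%:E)%E) ->
  spanned f.
Proof.
move=> mf hf; split=> // e e0.
have e6 : 0 < e / 2 / (2 + 1) by rewrite !divr_gt0// ltr_wpDr.
have e2 : 0 < e / 2 by rewrite divr_gt0.
have [g [mg hg] hfg] := hf _ e6; have [p tp hgp] := hg _ e6.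
exists p => //; have [mp _] := trig_bounded tp.
rewrite (_ : (fun x => _) = (fun x => (f x - g x) + (g x - p x))); last first.
  by apply/funext => x; rewrite addrA subrK.
apply: le_lt_trans (msqD_le (cmeasurableB mf mg) (cmeasurableB mg mp)) _.
have -> : e%:E = ((e / 2)%:E + (e / 2)%:E)%E by rewrite -EFinD -splitr.
by apply: lteD; apply: msq_scale_lt.
Qed.

Lemma spannedD f g : spanned f -> spanned g -> spanned (fun x => f x + g x).
Proof.
move=> [mf hf] [mg hg]; split=> [|e e0]; first exact: cmeasurableD.
have e6 : 0 < e / 2 / (2 + 1) by rewrite !divr_gt0// ltr_wpDr.
have e2 : 0 < e / 2 by rewrite divr_gt0.
have [p tp hp] := hf _ e6; have [p' tp' hp'] := hg _ e6.
exists (fun x => p x + p' x); first exact: trigD.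
have [mp _] := trig_bounded tp; have [mp' _] := trig_bounded tp'.
rewrite (_ : (fun x => _) = (fun x => (f x - p x) + (g x - p' x))); last first.
  by apply/funext => x; ring.
apply: le_lt_trans (msqD_le (cmeasurableB mf mp) (cmeasurableB mg mp')) _.
have -> : e%:E = ((e / 2)%:E + (e / 2)%:E)%E by rewrite -EFinD -splitr.
by apply: lteD; apply: msq_scale_lt.
Qed.

Lemma spannedZ c f : spanned f -> spanned (fun x => c * f x).
Proof.
move=> [mf hf]; split=> [|e e0].
  by apply: cmeasurableM => //; exact: cmeasurable_cst.
have e1 : 0 < e / (sqn c + 1) by rewrite divr_gt0// ltr_wpDl// sqn_ge0.
have [p tp hp] := hf _ e1; exists (fun x => c * p x); first exact: trigZ.
have [mp _] := trig_bounded tp.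
rewrite (_ : (fun x => _) = (fun x => c * (f x - p x))); last first.
  by apply/funext => x; rewrite mulrBr.
apply: le_lt_trans (msq_mul_le (M := sqn c) (cmeasurableB mf mp) (cmeasurable_cst c) _) _ => //.
by apply: msq_scale_lt => //; exact: sqn_ge0.
Qed.

Lemma spanned0 : spanned (fun=> 0).
Proof.
split; first exact: cmeasurable_cst.
move=> e e0; exists (fun=> 0); first by exists [::]; split => // x; rewrite big_nil.
by rewrite /msq integral0_eq ?lte_fin// => x _; rewrite subrr sqn0.
Qed.

Lemma spanned_sum I (s : seq I) (F : I -> T -> R[i]) :
  (forall i, spanned (F i)) -> spanned (fun x => \sum_(i <- s) F i x).
Proof.
move=> hF; elim: s => [|i s IHs].
  by under eq_fun do rewrite big_nil; exact: spanned0.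
by under eq_fun do rewrite big_cons; exact: spannedD.
Qed.

Lemma spanned_fin f : spanned f -> (msq f < +oo)%E.
Proof.
move=> [mf hf]; have [p tp hp] := hf 1 ltr01; have [mp [M hM]] := trig_bounded tp.
rewrite (_ : f = (fun x => (f x - p x) + p x)); last by apply/funext => x; rewrite subrK.
apply: le_lt_trans (msqD_le (cmeasurableB mf mp) mp) _.
apply: lte_add_pinfty; first by rewrite lte_mul_pinfty// (lt_trans hp) ?ltry.
rewrite lte_mul_pinfty//.
apply: (@le_lt_trans _ _ (\int[mu]_x (M%:E))%E); last first.
  by rewrite integral_cst// [X in (_ * X)%E](probability_setT mu) mule1 ltry.
apply: ge0_le_integral => //.
- by move=> x _; rewrite lee_fin sqn_ge0.
- exact: measurable_sqnE.
- by move=> x _; rewrite lee_fin.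
Qed.

End density.

(** * Multipliers of the span *)

Section multipliers.
Variables (R : realType) (mu : probability (measurableTypeR R) R) (L : set R).
Local Notation T := (measurableTypeR R).
Implicit Types f g h : T -> R[i].
Local Notation msq := (msq mu).
Local Notation spanned := (spanned mu L).

Hypothesis spanned_exp : forall t, spanned (expfun t).

Lemma msq_dominated (d_ : nat -> T -> R[i]) (G : T -> R) :
  (forall n, cmeasurable (d_ n)) -> mu.-integrable setT (EFin \o G) ->
  (forall n x, sqn (d_ n x) <= G x) ->
  {ae mu, forall x : T, sqn (d_ n x) @[n --> \oo] --> (0 : R)} ->
  forall e : R, 0 < e -> exists n, (msq (d_ n) < e%:E)%E.
Proof.
move=> md iG dG cv e e0.
have m_ n : measurable_fun setT (fun x => (sqn (d_ n x))%:E).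
  by apply/measurable_EFinP; exact: measurable_sqn.
have cv' : {ae mu, forall x : T, setT x ->
    (fun n => (sqn (d_ n x))%:E) @ \oo --> cst (0%E : \bar R) x}.
  apply: filterS cv => x cx _; exact: cvg_comp cx _.
have dom : {ae mu, forall (x : T) n, setT x -> (`|(sqn (d_ n x))%:E| <= (EFin \o G) x)%E}.
  by apply: aeW => x n _; rewrite gee0_abs ?lee_fin ?sqn_ge0.
have [_ _] := dominated_convergence measurableT m_ (measurable_cst _) cv' iG dom.
rewrite integral0 => c.
have e0' : (0 < e%:E)%E by rewrite lte_fin.
have [N _ hN] := c _ (open_ereal_lt' e0').
by exists N; exact: (hN N (leqnn N)).
Qed.

(** The bounded functions that preserve the span form an algebra that contains
    every exponential, and dominated convergence closes it under bounded pointwise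
    limits. Working with multipliers instead of elements of the span makes products
    available. *)
Definition multiplier g : Prop := [/\ cmeasurable g, cbounded g &
  forall h, spanned h -> spanned (fun x => g x * h x)].

Lemma multiplierD g g' : multiplier g -> multiplier g' -> multiplier (fun x => g x + g' x).
Proof.
move=> [mg bg hg] [mg' bg' hg']; split; [exact: cmeasurableD|exact: cboundedD|].
move=> h sh; rewrite (_ : (fun x => _) = (fun x => g x * h x + g' x * h x)).
  by apply: spannedD; [exact: hg|exact: hg'].
by apply/funext => x; rewrite mulrDl.
Qed.

Lemma multiplierM g g' : multiplier g -> multiplier g' -> multiplier (fun x => g x * g' x).
Proof.
move=> [mg bg hg] [mg' bg' hg']; split; [exact: cmeasurableM|exact: cboundedM|].
move=> h sh; rewrite (_ : (fun x => _) = (fun x => g x * (g' x * h x))).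
  by apply: hg; exact: hg'.
by apply/funext => x; rewrite mulrA.
Qed.

Lemma multiplier_cst c : multiplier (fun=> c).
Proof.
split; [exact: cmeasurable_cst|exact: cbounded_cst|].
by move=> h; exact: spannedZ.
Qed.

Lemma multiplier_exp t : multiplier (expfun t).
Proof.
split; [exact: cmeasurable_exp|exact: cbounded_exp|].
move=> h [mh hh]; apply: spanned_lim.
  by apply: cmeasurableM => //; exact: cmeasurable_exp.
move=> e e0; have [p [s [Ls hs]] hp] := hh _ e0.
exists (fun x => expfun t x * p x).
  rewrite (_ : (fun x => _) = (fun x => \sum_(u <- s) u.2 * expfun (t + u.1) x)).
    by apply: spanned_sum => u; apply: spannedZ; exact: spanned_exp.
  apply/funext => x; rewrite hs mulr_sumr; apply: eq_bigr => u _.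
  by rewrite mulrCA !expfunE mulrDl cisD.
rewrite /msq; under eq_integral do rewrite -mulrBr sqnM expfunE sqn_cis mul1r.
exact: hp.
Qed.

(** For [h] in the span, $|(g_n - g) h|^2$ tends to $0$ and is dominated by
    $4 M |h|^2$. *)
Lemma multiplier_lim (g_ : nat -> T -> R[i]) g M : cmeasurable g ->
  (forall n, multiplier (g_ n)) -> (forall n x, sqn (g_ n x) <= M) ->
  (forall x, sqn (g x) <= M) ->
  {ae mu, forall x : T, sqn (g_ n x - g x) @[n --> \oo] --> (0 : R)} ->
  multiplier g.
Proof.
move=> mg Ag_ g_M gM cv; split=> //; first by exists M.
move=> h sh; have [mh _] := sh; apply: spanned_lim; first exact: cmeasurableM.
move=> e e0.
have mg_ n : cmeasurable (g_ n) by have [] := Ag_ n.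
have M0 : 0 <= M by apply: le_trans (gM 0); exact: sqn_ge0.
have md n : cmeasurable (fun x => g x * h x - g_ n x * h x).
  by apply: cmeasurableB; exact: cmeasurableM.
have ih : mu.-integrable setT (EFin \o (fun x => (4 * M) * sqn (h x))).
  apply: integrable_mull; apply/integrableP; split.
    by apply/measurable_EFinP; exact: measurable_sqn.
  under eq_integral do rewrite /= ger0_norm ?sqn_ge0//.
  exact: spanned_fin sh.
have eqd n x : g x * h x - g_ n x * h x = (- (g_ n x - g x)) * h x.
  by rewrite opprB mulrBl.
have [n hn] : exists n, (msq (fun x => (g x * h x - g_ n x * h x)%R) < e%:E)%E.
  apply: (msq_dominated md ih) => // [n x|].
    rewrite eqd sqnM sqnN ler_wpM2r ?sqn_ge0//; apply: le_trans (sqnB _ _) _.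
    by have := g_M n x; have := gM x; lra.
  apply: filterS cv => x cx; under eq_fun do rewrite eqd sqnM sqnN.
  have := cvgM cx (cvg_cst (sqn (h x))).
  rewrite mul0r => c; exact: c.
by exists (fun x => g_ n x * h x); last exact: hn; have [_ _] := Ag_ n; apply.
Qed.

End multipliers.

(** * Polynomial approximation of the sign *)

Section sign_iteration.
Variable R : realType.
Implicit Types x y : R.

(** On $[-1, 1]$ the odd cubic $y \mapsto (3y - y^3)/2$ attracts the positive
    points to $1$ and the negative ones to $-1$: its iterates are polynomials that
    tend to the sign function. *)
Definition cubic y : R := (3 * y - y ^+ 3) / 2.

Lemma cubic_ge0 y : 0 <= y <= 1 -> y <= cubic y <= 1.
Proof.
move=> /andP[y0 y1]; rewrite /cubic; have := sqr_ge0 (1 - y) => h.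
have h1 : 0 <= (1 - y) ^+ 2 * (2 + y) by rewrite mulr_ge0//; lra.
have h2 : 0 <= y * (1 - y) * (1 + y) by rewrite !mulr_ge0//; lra.
by apply/andP; split; nra.
Qed.

Lemma cubicN y : cubic (- y) = - cubic y.
Proof. by rewrite /cubic; field. Qed.

Lemma iter_cubicN n y : iter n cubic (- y) = - iter n cubic y.
Proof. by elim: n => [//|n /= ->]; rewrite cubicN. Qed.

Lemma iter_cubic_ge0 n y : 0 <= y <= 1 ->
  y <= iter n cubic y /\ 1 - (1 - y / 2) ^+ n <= iter n cubic y <= 1.
Proof.
move=> /andP[y0 y1]; elim: n => [|n [IH1 /andP[IH2 IH3]]].
  by rewrite expr0 subrr /= lexx y0 y1.
rewrite iterS; set z := iter n cubic y in IH1 IH2 IH3 *.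
have /andP[c1 c2] : z <= cubic z <= 1 by apply: cubic_ge0; rewrite (le_trans y0 IH1).
split; first exact: le_trans IH1 c1.
rewrite c2 andbT exprS; set p := (1 - y / 2) ^+ n in IH2 *.
have e : 1 - cubic z = (1 - z) * (1 - z * (1 + z) / 2) by rewrite /cubic; field.
have h1 : (1 - z) * (1 - z * (1 + z) / 2) <= (1 - z) * (1 - y / 2).
  rewrite ler_wpM2l//; first by lra.
  by nra.
have h2 : (1 - z) * (1 - y / 2) <= p * (1 - y / 2) by rewrite ler_wpM2r//; lra.
by lra.
Qed.

Lemma iter_cubic_bound n y : `|y| <= 1 -> `|iter n cubic y| <= 1.
Proof.
move=> y1; have [y0|y0] := leP 0 y.
  have [h1 /andP[_ h2]] := @iter_cubic_ge0 n y ltac:(by rewrite y0 -(ger0_norm y0)).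
  by rewrite ger0_norm// (le_trans y0 h1).
have y0' : 0 <= - y <= 1 by rewrite -(ltr0_norm y0) normr_ge0.
have [h1 /andP[_ h2]] := @iter_cubic_ge0 n (- y) y0'.
rewrite -[y]opprK iter_cubicN normrN ger0_norm//.
by case/andP: y0' => y0' _; exact: le_trans y0' h1.
Qed.

Lemma cvg_iter_cubic y : 0 < y <= 1 -> iter n cubic y @[n --> \oo] --> (1 : R).
Proof.
move=> /andP[y0 y1].
have yb : 0 <= y <= 1 by rewrite y1 ltW.
have c : (fun n => 1 - (1 - y / 2) ^+ n) @ \oo --> (1 : R).
  rewrite -[X in _ --> X]subr0; apply: cvgB; first exact: cvg_cst.
  by apply: cvg_expr; rewrite ger0_norm; lra.
apply: (squeeze_cvgr _ c (cvg_cst (1 : R))).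
by apply: nearW => n; have [_] := iter_cubic_ge0 n yb.
Qed.

Definition soft_step n y : R := (iter n cubic y ^+ 2 + iter n cubic y) / 2.

Lemma soft_step_bound n y : `|y| <= 1 -> `|soft_step n y| <= 1.
Proof.
move=> /(iter_cubic_bound n); rewrite /soft_step; move: (iter n cubic y) => z.
by rewrite !ler_norml => /andP[z0 z1]; apply/andP; split; nra.
Qed.

Lemma cvg_soft_step y : `|y| <= 1 -> soft_step n y @[n --> \oo] --> ((0 < y)%R%:R : R).
Proof.
rewrite ler_norml => /andP[y1 y2].
have main (z l : R) : iter n cubic z @[n --> \oo] --> l ->
    soft_step n z @[n --> \oo] --> (l ^+ 2 + l) / 2.
  move=> c; apply: cvgM; last exact: cvg_cst.
  by apply: cvgD => //; rewrite expr2; under eq_fun do rewrite expr2; exact: cvgM.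
have [y0|y0|y0] := ltgtP 0 y.
- have := main _ _ (@cvg_iter_cubic y ltac:(by rewrite y0 y2)).
  by rewrite expr1n (_ : (1 + 1) / 2 = 1 :> R)//; field.
- have c : iter n cubic y @[n --> \oo] --> (- 1 : R).
    rewrite -[y]opprK; under eq_fun do rewrite iter_cubicN.
    by apply: cvgN; apply: cvg_iter_cubic; rewrite oppr_gt0 y0 lerNl.
  have := main _ _ c.
  by rewrite sqrrN expr1n subrr mul0r.
- rewrite -y0; have c : iter n cubic 0 @[n --> \oo] --> (0 : R).
    apply: cvg_near_cst; apply: nearW => n; elim: n => [//|n /= ->].
    by rewrite /cubic mulr0 expr0n /= subrr mul0r.
  have := main _ _ c.
  by rewrite expr0n /= addr0 mul0r.
Qed.

End sign_iteration.

(** * Indicators and nonnegative functions in the span *)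

Section totality.
Variables (R : realType) (mu : probability (measurableTypeR R) R) (L : set R).
Local Notation T := (measurableTypeR R).
Implicit Types f g h : T -> R[i].
Local Notation msq := (msq mu).
Local Notation spanned := (spanned mu L).
Local Notation multiplier := (multiplier mu L).

Hypothesis spanned_exp : forall t, spanned (expfun t).
Hypothesis ae_norm_le1 : {ae mu, forall x : T, `|x| <= 1}.

Lemma multiplier_sin t a : multiplier (fun x => (sin (2 * pi * (t * (x - a))))%:C).
Proof.
pose z x := cis (- (t * a)) * expfun t x.
pose zc x := conjc (cis (- (t * a))) * expfun (- t) x.
rewrite (_ : (fun x => _) = (fun x => Complex 0 2^-1 * (zc x + (-1) * z x))).
  apply: multiplierM; first exact: multiplier_cst.
  apply: multiplierD.
    by apply: multiplierM; [exact: multiplier_cst|exact: multiplier_exp].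
  apply: multiplierM; first exact: multiplier_cst.
  by apply: multiplierM; [exact: multiplier_cst|exact: multiplier_exp].
apply/funext => x.
have zE : z x = cis (t * (x - a)).
  by rewrite /z expfunE -cisD; congr cis; ring.
have zcE : zc x = conjc (cis (t * (x - a))).
  by rewrite /zc expfunE -cisN -cisN -cisD; congr cis; ring.
by rewrite zE zcE mulN1r /cis; apply: complex_ext => /=; field.
Qed.

Lemma multiplier_realM (s s' : T -> R) : multiplier (fun x => (s x)%:C) ->
  multiplier (fun x => (s' x)%:C) -> multiplier (fun x => (s x * s' x)%:C).
Proof.
move=> ms ms'; rewrite (_ : (fun x => _) = (fun x => (s x)%:C * (s' x)%:C)).
  exact: multiplierM.
by apply/funext => x; rewrite rmorphM.
Qed.

Lemma multiplier_realD (s s' : T -> R) : multiplier (fun x => (s x)%:C) ->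
  multiplier (fun x => (s' x)%:C) -> multiplier (fun x => (s x + s' x)%:C).
Proof.
move=> ms ms'; rewrite (_ : (fun x => _) = (fun x => (s x)%:C + (s' x)%:C)).
  exact: multiplierD.
by apply/funext => x; rewrite rmorphD.
Qed.

Lemma multiplier_soft_step n (s : T -> R) : multiplier (fun x => (s x)%:C) ->
  multiplier (fun x => (soft_step n (s x))%:C).
Proof.
have cst c : multiplier (fun x => c%:C) by exact: multiplier_cst.
have iterm : forall m (s : T -> R), multiplier (fun x => (s x)%:C) ->
    multiplier (fun x => (iter m (@cubic R) (s x))%:C).
  elim=> [//|m IHm] u mu_; rewrite (_ : (fun x => _) = (fun x =>
     ((3 / 2) * iter m (@cubic R) (u x) + (- 2^-1) * (iter m (@cubic R) (u x) *
      (iter m (@cubic R) (u x) * iter m (@cubic R) (u x))))%:C)).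
    have hu := IHm u mu_.
    exact: (multiplier_realD (multiplier_realM (cst _) hu)
      (multiplier_realM (cst _) (multiplier_realM hu (multiplier_realM hu hu)))).
  by apply/funext => x /=; rewrite {1}/cubic; congr (_%:C); field.
move=> ms; rewrite (_ : (fun x => _) = (fun x => (2^-1 * (iter n (@cubic R) (s x) *
   iter n (@cubic R) (s x) + iter n (@cubic R) (s x)))%:C)).
  apply: multiplier_realM => //; apply: multiplier_realD; last exact: iterm.
  by apply: multiplier_realM; exact: iterm.
by apply/funext => x; congr (_%:C); rewrite /soft_step; field.
Qed.

Lemma cvg_sqrB (u : nat -> R) l : u n @[n --> \oo] --> l ->
  (u n - l) ^+ 2 @[n --> \oo] --> (0 : R).
Proof.
move=> c; under eq_fun do rewrite expr2.
by have := cvgM (cvgB c (cvg_cst l)) (cvgB c (cvg_cst l)); rewrite subrr mulr0 => d; exact: d.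
Qed.

Lemma sqn_indic (E : set T) x : sqn (\1_E x)%:C <= (1 : R).
Proof. by rewrite sqn_real indicE; case: (x \in E); rewrite ?expr1n ?expr0n. Qed.

(** For $|x| \le 1$ the sign of $x - a$ is that of a sine whose angle stays
    within a quarter turn. *)
Lemma multiplier_half_line a :
  multiplier (fun x => (\1_(`]a, +oo[%classic : set T) x)%:C).
Proof.
pose t := (4 * (1 + `|a|))^-1.
have a0 : 0 < 1 + `|a| by rewrite ltr_wpDr.
have t0 : 0 < t by rewrite invr_gt0 mulr_gt0.
pose s (x : T) := sin (2 * pi * (t * (x - a))).
apply: (@multiplier_lim _ _ _ (fun n x => (soft_step n (s x))%:C) _ 1).
- apply: cmeasurable_real; apply: measurable_indic; exact: measurable_itv.
- by move=> n; apply: multiplier_soft_step; exact: multiplier_sin.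
- move=> n x; rewrite sqn_real -[leLHS]real_normK ?num_real// exprn_ile1//.
  exact/soft_step_bound/sin_max.
- by move=> x; exact: sqn_indic.
apply: filterS ae_norm_le1 => x x1.
have -> : \1_(`]a, +oo[%classic : set T) x = (0 < s x)%R%:R :> R.
  rewrite indicE mem_setE in_itv /= andbT; congr (nat_of_bool _)%:R.
  have pi0 := pi_gt0 R.
  have tE : t * (1 + `|a|) = 4^-1 by rewrite /t invfM mulfVK// gt_eqF.
  have bd : `|t * (x - a)| <= 4^-1.
    rewrite normrM (gtr0_norm t0) -tE ler_pM2l//.
    by apply: le_trans (ler_normB _ _) _; rewrite lerD2r.
  have [xa|xa] := ltP a x.
    rewrite /s; apply/esym/sin_gt0_pi; move: bd; rewrite ler_norml => /andP[_ bd].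
    have p : 0 < t * (x - a) by rewrite mulr_gt0// subr_gt0.
    move: (t * (x - a)) p bd => p p0 bd.
    by apply/andP; split; [rewrite mulr_gt0// mulr_gt0|nra].
  apply/esym/negbTE; rewrite -leNgt /s -oppr_ge0 -sinN; apply: sin_ge0_pi.
  move: bd; rewrite ler_norml => /andP[bd _].
  have p : t * (x - a) <= 0 by rewrite pmulr_rle0// subr_le0.
  move: (t * (x - a)) p bd => p p0 bd.
  by apply/andP; split; nra.
have c := cvg_soft_step (sin_max (2 * pi * (t * (x - a)))).
rewrite -/(s x) in c.
under eq_fun do rewrite -rmorphB /= sqn_real.
exact: cvg_sqrB.
Qed.

(** The sets whose indicator is a multiplier form a sigma-algebra: products give
    intersections, and a countable union is the increasing limit of finite ones.
    Half-lines generate the Borel sets. *)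
Lemma multiplier_indic (E : set T) : measurable E ->
  multiplier (fun x => (\1_E x)%:C).
Proof.
move=> mE; suff [//] : measurable E /\ multiplier (fun x => (\1_E x)%:C).
have mult1 : multiplier (fun x => (1 : R)%:C) by exact: multiplier_cst.
have multN1 : multiplier (fun x => (- 1 : R)%:C) by exact: multiplier_cst.
have compl A : multiplier (fun x => (\1_A x)%:C) -> multiplier (fun x => (\1_(~` A) x)%:C).
  move=> hA; rewrite (_ : (fun x => _) = (fun x => (1 + (-1) * \1_A x)%:C)).
    by apply: multiplier_realD => //; exact: multiplier_realM.
  apply/funext => x; congr (_%:C); rewrite !indicE in_setC.
  by case: (x \in A); rewrite /= ?mulr1 ?mulr0 ?subrr ?addr0.
have inter A B : multiplier (fun x => (\1_A x)%:C) -> multiplier (fun x => (\1_B x)%:C) ->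
    multiplier (fun x => (\1_(A `&` B) x)%:C).
  move=> hA hB; rewrite (_ : (fun x => _) = (fun x => (\1_A x * \1_B x)%:C)).
    exact: multiplier_realM.
  by apply/funext => x; congr (_%:C); rewrite indicI.
have union A B : multiplier (fun x => (\1_A x)%:C) -> multiplier (fun x => (\1_B x)%:C) ->
    multiplier (fun x => (\1_(A `|` B) x)%:C).
  move=> hA hB; rewrite -[A `|` B]setCK setCU; apply: (compl).
  by apply: inter; exact: compl.
pose G := [set A : set T | measurable A /\ multiplier (fun x => (\1_A x)%:C)].
have sG : sigma_algebra setT G.
  split.
  - split; first exact: measurable0.
    by rewrite indic0; exact: (@multiplier_cst _ mu L (0 : R)%:C).
  - by move=> A [mA hA]; rewrite setTD; split; [exact: measurableC|exact: compl].
  move=> F hF; have mF n : measurable (F n) by have [] := hF n.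
  have mU : measurable (\bigcup_n F n) by exact: bigcup_measurable.
  split=> //.
  pose U n := \big[setU/set0]_(i < n) F i.
  apply: (@multiplier_lim _ _ _ (fun n x => (\1_(U n) x)%:C) _ 1).
  - by apply: cmeasurable_real; exact: measurable_indic.
  - elim=> [|n IHn]; first by rewrite /U big_ord0 indic0;
      exact: (@multiplier_cst _ mu L (0 : R)%:C).
    by rewrite /U big_ord_recr; apply: union => //; have [] := hF n.
  - by move=> n x; exact: sqn_indic.
  - by move=> x; exact: sqn_indic.
  apply: aeW => x; apply: cvg_near_cst.
  have [[n _ Fnx]|nF] := pselect ((\bigcup_n F n) x).
    exists n.+1 => // m /= nm.
    have Ux : U m x by rewrite /U -bigcup_mkord; exists n.
    have Fx : (\bigcup_n F n) x by exists n.
    by rewrite !indicE !mem_set// subrr sqn0.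
  apply: nearW => m.
  have Ux : ~ U m x by rewrite /U -bigcup_mkord => -[i _ Fix]; apply: nF; exists i.
  by rewrite !indicE !memNset// subrr sqn0.
suff : <<s (@RGenOInfty.G R) >> `<=` G.
  apply; have := mE.
  by rewrite -[measurable E]/((@ocitv R).-sigma.-measurable E) RGenOInfty.measurableE.
apply: smallest_sub => // _ [a ->]; split; first exact: measurable_itv.
exact: multiplier_half_line.
Qed.

Lemma spanned_indic (E : set T) : measurable E -> spanned (fun x => (\1_E x)%:C).
Proof.
move=> /multiplier_indic[_ _ /(_ _ (spanned_exp 0))].
by congr spanned; apply/funext => x; rewrite expfunE mul0r cis0 mulr1.
Qed.

Import HBNNSimple.

Lemma spanned_nnsfun (f : {nnsfun T >-> R}) : spanned (fun x => (f x)%:C).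
Proof.
rewrite (_ : (fun x => _) = (fun x => \sum_(y <- finmap.enum_fset (fset_set (range f)))
   (y%:C * (\1_(f @^-1` [set y]) x)%:C))).
  by apply: spanned_sum => y; apply: spannedZ; exact: spanned_indic.
apply/funext => x; rewrite [X in X%:C]fimfunE fsbig_finite//= rmorph_sum /=.
by apply: eq_bigr => y _; rewrite rmorphM.
Qed.

(** Simple functions increase to [f], and the squared error is dominated by the
    integrable function $f^2$. *)
Lemma spanned_ge0 (f : T -> R) : measurable_fun setT f -> (forall x, 0 <= f x) ->
  (msq (fun x => (f x)%:C) < +oo)%E -> spanned (fun x => (f x)%:C).
Proof.
move=> mf f0 ffin.
have mfE : measurable_fun setT (EFin \o f) by apply/measurable_EFinP.
pose f_ := nnsfun_approx measurableT mfE.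
have f0E x : setT x -> (0 <= (EFin \o f) x)%E by rewrite lee_fin.
have cf x : f_ n x @[n --> \oo] --> f x.
  have := cvg_nnsfun_approx measurableT mfE f0E (x := x) I.
  by move/fine_cvg.
have f_le n x : f_ n x <= f x.
  by rewrite -lee_fin /f_ nnsfun_approxE; exact: le_approx.
apply: spanned_lim; first exact: cmeasurable_real.
move=> e e0.
have [n hn] : exists n, (msq (fun x => ((f x)%:C - (f_ n x)%:C)%R) < e%:E)%E.
  apply: (@msq_dominated _ _ _ (fun x => f x ^+ 2)) => //.
  - move=> n; apply: cmeasurableB; exact: cmeasurable_real.
  - apply/integrableP; split; first by apply/measurable_EFinP; exact: measurable_funX.
    under eq_integral do rewrite /= ger0_norm ?sqr_ge0// -sqn_real.
    exact: ffin.
  - move=> n x; rewrite -rmorphB sqn_real; have := f_le n x.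
    have : 0 <= f_ n x by []. 
    by move=> ? ?; rewrite lerXn2r ?nnegrE// ?subr_ge0// gerBl.
  apply: aeW => x; under eq_fun do rewrite -rmorphB sqn_real -sqrrN opprB.
  exact: cvg_sqrB.
by exists (fun x => (f_ n x)%:C); first exact: spanned_nnsfun.
Qed.

End totality.

(** * Completeness and the spectral theorem *)

Section L2_spanned.
Variables (R : realType) (mu : probability (measurableTypeR R) R) (L : set R).
Local Notation T := (measurableTypeR R).
Implicit Types f g h : T -> R[i].
Local Notation msq := (msq mu).
Local Notation spanned := (spanned mu L).

Lemma L2norm_sqr f : (L2norm mu f `^ 2 = msq f)%E.
Proof.
rewrite /L2norm powR_Lnorm//; apply: eq_integral => x _.
rewrite gee0_abs ?lee_fin; last by case: (f x) => u v /=; rewrite sqrtr_ge0.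
rewrite poweR_EFin powR_mulrn ?normc_sqr//.
by case: (f x) => u v /=; rewrite sqrtr_ge0.
Qed.

Lemma L2norm_lt_pinfty f : (L2norm mu f < +oo)%E <-> (msq f < +oo)%E.
Proof.
rewrite -L2norm_sqr; split; first exact: poweR_lty.
by apply: lty_poweRy.
Qed.

Lemma L2norm_lt f (e : R) : 0 < e -> (msq f < (e ^+ 2)%:E)%E -> (L2norm mu f < e%:E)%E.
Proof.
move=> e0; apply: contraTT; rewrite -!leNgt => eN.
have : (e%:E `^ 2 <= L2norm mu f `^ 2)%E.
  apply: (@gt0_ler_poweR R 2) => //; rewrite in_itv /= leey andbT.
    by rewrite lee_fin ltW.
  exact: Lnorm_ge0.
by rewrite L2norm_sqr poweR_EFin powR_mulrn// ltW.
Qed.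

(** Terms with equal frequency are collected, since a linear combination indexed by
    frequencies carries a single coefficient function. *)
Lemma trig_regroup p : trig L p -> exists (s : seq R) (c : R -> R[i]),
  (forall l, l \in s -> L l) /\ forall x, p x = \sum_(l <- s) c l * expfun l x.
Proof.
move=> [s [Ls ps]]; exists (undup [seq u.1 | u <- s]).
exists (fun l => \sum_(u <- s | u.1 == l) u.2); split.
  by move=> l; rewrite mem_undup => /mapP[u us ->]; exact: Ls.
move=> x; rewrite ps.
under [RHS]eq_bigr do rewrite mulr_suml.
rewrite (exchange_big_dep xpredT)//= big_seq [RHS]big_seq; apply: eq_bigr => u us.
rewrite -big_filter; have -> : [seq l <- undup [seq u.1 | u <- s] | u.1 == l] = [:: u.1].
  rewrite (eq_filter (a2 := pred1 u.1)); last by move=> l; rewrite /= eq_sym.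
  by rewrite filter_pred1_uniq ?undup_uniq// mem_undup map_f.
by rewrite big_seq1.
Qed.

Hypothesis spanned_exp : forall t, spanned (expfun t).
Hypothesis ae_norm_le1 : {ae mu, forall x : T, `|x| <= 1}.

Let msq_le f g : cmeasurable f -> cmeasurable g -> (forall x, sqn (f x) <= sqn (g x)) ->
  (msq g < +oo)%E -> (msq f < +oo)%E.
Proof.
move=> mf mg fg; apply: le_lt_trans; apply: ge0_le_integral => //.
- by move=> x _; rewrite lee_fin sqn_ge0.
- by apply/measurable_EFinP; exact: measurable_sqn.
- by apply/measurable_EFinP; exact: measurable_sqn.
- by move=> x _; rewrite lee_fin.
Qed.

Lemma spanned_L2 f : in_L2 mu f -> spanned f.
Proof.
move=> [mr mi /L2norm_lt_pinfty fin].
have mf : cmeasurable f by split.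
have part (u : T -> R) : measurable_fun setT u -> (forall x, u x ^+ 2 <= sqn (f x)) ->
    spanned (fun x => (u x)%:C).
  move=> mu_ uf.
  have pos (v : T -> R) : measurable_fun setT v -> (forall x, v x ^+ 2 <= sqn (f x)) ->
      spanned (fun x => (Num.max (v x) 0)%:C).
    move=> mv vf; have mm : measurable_fun setT (fun x => Num.max (v x) 0).
      by apply: measurable_maxr.
    apply: (spanned_ge0 spanned_exp ae_norm_le1) => //.
      by move=> x; rewrite le_max lexx orbT.
    apply: (@msq_le _ f) => // x; rewrite sqn_real; apply: le_trans (vf x).
    by case: (leP (v x) 0) => _; rewrite ?expr0n ?sqr_ge0.
  rewrite (_ : (fun x => _) = (fun x => (Num.max (u x) 0)%:C + (-1) * (Num.max (- u x) 0)%:C)).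
    apply: spannedD; first exact: pos.
    apply: spannedZ; apply: (pos (fun x => - u x)); first exact: measurable_funN.
    by move=> x; rewrite sqrrN.
  apply/funext => x; rewrite mulN1r -rmorphB /=; congr (_%:C).
  by case: (leP (u x) 0); case: (leP (- u x) 0); lra.
rewrite (_ : f = (fun x => (complex.Re (f x))%:C + (Complex 0 1) * (complex.Im (f x))%:C)).
  apply: spannedD; first by apply: part => // x; rewrite lerDl sqr_ge0.
  by apply: spannedZ; apply: part => // x; rewrite lerDr sqr_ge0.
by apply/funext => x; exact: complexE.
Qed.

Lemma orthonormal_basis_exp :
  (forall l m, L l -> L m -> l != m -> muhat mu (l - m) = 0) ->
  orthonormal_basis mu L (@expfun R).
Proof.
move=> orth; split.
- move=> l _; have [m1 m2] := cmeasurable_exp l; split=> //.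
  by apply/L2norm_lt_pinfty; exact: spanned_fin (spanned_exp l).
- move=> l m Ll Lm; rewrite L2inner_expfun; have [->|lm] := eqVneq l m.
    by rewrite subrr muhat0.
  exact: orth.
move=> f /spanned_L2[mf hf] e e0.
have [p tp hp] := hf _ (exprn_gt0 2 e0).
have [s [c [Ls ps]]] := trig_regroup tp; exists s, c; split=> //.
apply: L2norm_lt => //; rewrite (_ : (fun x => _) = (fun x => f x - p x))//.
by apply/funext => x; rewrite ps.
Qed.

End L2_spanned.

Lemma spectral_mu (R : realType) (b q : nat) (mu : probability (measurableTypeR R) R) :
  (0 < q)%N -> (q < b)%N -> is_mu_qb q b mu -> (q %| b)%N -> spectral_measure mu.
Proof.
move=> q0 qb hmu qdvd; split; first exact: compactly_supported_mu q0 qb hmu.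
pose L : set R := (fun l : nat => l%:R) @` [set l | exists n, l \in Lam b q n].
exists L; split.
  exact: card_le_trans (card_image_le _ _) (countableP _).
apply: orthonormal_basis_exp.
- move=> t; split; first exact: cmeasurable_exp.
  move=> e e0; have [N hN] := exp_approx q0 qb hmu qdvd t e0.
  exists (fun x => \sum_(l <- [seq l%:R | l <- Lam b q N]) muhat mu (t - l) * expfun l x) => //.
  exists [seq (l%:R, muhat mu (t - l%:R)) | l <- Lam b q N]; split.
    by move=> _ /mapP[l hl ->] /=; exists l => //; exists N.
  by move=> x; rewrite !big_map.
- apply: filterS (ae_support q0 qb hmu) => x /andP[x0 x1].
  by rewrite ger0_norm// (le_trans x1)// ltW// rho_lt1.
move=> _ _ [l [n hl] <-] [m [n' hm] <-] lm.
apply: (@muhat_Lam_eq0 _ _ _ _ q0 qb hmu qdvd (maxn n n')).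
- exact: sub_Lam (leq_maxl _ _) _ hl.
- exact: sub_Lam (leq_maxr _ _) _ hm.
- by apply: contra lm => /eqP ->.
Qed.

Theorem theorem2p1 (R : realType) (b q : nat)
    (mu : probability (measurableTypeR R) R)
    (hb : (2 < b)%N) (hq : (1 <= q < b)%N) (hmu : is_mu_qb q b mu) :
  (infinitely_many_orthogonal_exponentials mu <-> (1 < gcdn q b)%N) /\
  ((q %| b)%N -> spectral_measure mu).
Proof.
have /andP[q0 qb] := hq; split; last exact: spectral_mu.
split=> [[L [infL orth]]|]; last exact: infinite_orthogonal q0 qb hmu.
rewrite ltn_neqAle gcdn_gt0 q0 andbT eq_sym; apply/negP => cop.
by apply: infL; exact: (finite_orthogonal q0 qb hmu cop orth).
Qed.
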